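(* Let $n\ge 2$ and let $g$ be the contravariant metric on the orbit space $\mathbb{C}^n/B_n$ induced by $g^{ij}(p)=\frac{1-\delta^{ij}}{p_ip_j}$, written in the basic invariants $u_1,\dots,u_n$ (normalized by dividing by the constant $4(n-1)$), and let $\eta^{ij}(u)=\frac{\partial g^{ij}}{\partial u_{n-1}}(u)$. Then the flat pencil of contravariant metrics $g-\lambda\eta$ gives rise to a Dubrovin–Frobenius manifold structure on $\mathbb{C}^n/B_n$ (on the open subset where $u_n\neq 0$), whose invariant flat metric is $\eta$ and whose intersection form is $g$.
   Context: $B_n$ is the hyperoctahedral Coxeter group acting on $\mathbb{C}^n$ (coordinates $p_1,\dots,p_n$) by permutations and sign changes of the coordinates, i.e. generated by the reflections in the hyperplanes $p_j=0$ and $p_i\pm p_j=0$. The basic invariants are $u_k=\sum_{1\le i_1<\dots<i_k\le n}p_{i_1}^2\cdots p_{i_k}^2$ ($k=1,\dots,n$), with $u_0=1$ and $u_k=0$ for $k<0$ or $k>n$; so $u_n=(p_1\cdots p_n)^2$. The cometric in these coordinates is $g^{ij}(u)=\sum_{k,l}g^{kl}(p)\frac{\partial u_i}{\partial p_k}\frac{\partial u_j}{\partial p_l}$ (it is polynomial in $u$). A pair of contravariant metrics $(g,\eta)$ is a flat pencil if $g-\lambda\eta$ is flat for every $\lambda$ and its contravariant Christoffel symbols are $\Gamma^{ij}_{g,k}-\lambda\Gamma^{ij}_{\eta,k}$. A Dubrovin–Frobenius manifold is a manifold with a flat metric $\eta$, a commutative associative product $\circ$ on tangent spaces with $\eta(X\circ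 Y,Z)=\eta(X,Y\circ Z)$, $\nabla^\eta$-flat unit $e$, symmetric $\nabla^\eta c$ for the structure constants $c$, and an Euler vector field $E$ with $[e,E]=e$, $\mathcal{L}_E\circ=\circ$, $\mathcal{L}_E\eta=(2-d)\eta$; its intersection form is the cometric $(E\circ)\eta^{-1}$. *)

(* Defs.v *)
From HB Require Import structures.
From mathcomp Require Import all_boot all_order all_algebra.
From mathcomp Require Import all_classical all_reals all_analysis.
From mathcomp Require Import complex.
Set Implicit Arguments. Unset Strict Implicit. Unset Printing Implicit Defensive.
Import Order.TTheory GRing.Theory Num.Theory.
Import numFieldTopology.Exports numFieldNormedType.Exports.
Local Open Scope ring_scope.

(* Points of C^n are row vectors 'rV[R[i]]_n; coordinates are indexed
   0-based: coordinate k : 'I_n is the (k+1)-st coordinate of the paper. *)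

(* The complex numbers C = R[i] over a real field R, packaged as a numFieldType
   so that MathComp-Analysis' (modulus) topology and normed structure apply. *)
Definition Cx (R : realType) : numFieldType := R[i].

Section FrobDefs.
Variable R : realType.
Local Notation C := (Cx R).
Variable n : nat.
Local Notation pt := 'rV[C]_n.

Definition ecoord (m : nat) : pt := \row_(k < n) ((k : nat) == m)%:R.

Definition pd (f : pt -> C) (m : nat) (x : pt) : C :=
  'D_(ecoord m) f x.

Definition holo_on (U : set pt) (f : pt -> C) : Prop :=
  forall x, U x -> differentiable f x.

Definition inv_u (p : pt) : pt :=
  \row_(i < n) \sum_(S : {set 'I_n} | #|S| == i.+1) \prod_(a in S) (p 0 a) ^+ 2.

Definition Udom : set pt := [set u | forall k : 'I_n, (k : nat) = n.-1 -> u 0 k != 0].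

(* cometric g^{ij}(u) pulled back from g^{kl}(p) = (1 - delta^{kl})/(p_k p_l),
   evaluated at u = u(p):  sum_{k,l} g^{kl}(p) du_i/dp_k du_j/dp_l *)
Definition g_pullback (p : pt) (i j : 'I_n) : C :=
  \sum_(k < n) \sum_(l < n)
     ((1 - ((k == l) : nat)%:R) / (p 0 k * p 0 l)) *
     pd (fun q => inv_u q 0 i) k p * pd (fun q => inv_u q 0 j) l p.

(* eta^{ij}(u) = d g^{ij} / d u_{n-1} (u) ; u_{n-1} is the 0-based coordinate n-2 *)
Definition eta_of (g : pt -> 'M[C]_n) (u : pt) : 'M[C]_n :=
  \matrix_(i, j) pd (fun v => g v i j) n.-2 u.

Variable eta : pt -> 'M[C]_n.          (* contravariant components eta^{ij} *)

Definition etal (u : pt) : 'M[C]_n := invmx (eta u).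

Definition Chr (k i j : 'I_n) (u : pt) : C :=
  2^-1 * \sum_(l < n) eta u k l *
     (pd (fun v => etal v l j) i u + pd (fun v => etal v l i) j u
      - pd (fun v => etal v i j) l u).

Definition Riem (l i j k : 'I_n) (u : pt) : C :=
  pd (Chr l k i) j u - pd (Chr l j i) k u
  + \sum_(m < n) (Chr l j m u * Chr m k i u - Chr l k m u * Chr m j i u).

(* Structure constants: c i j k u = c^k_{ij}(u), i.e. d_i o d_j = sum_k c^k_{ij} d_k *)
Variable c : 'I_n -> 'I_n -> 'I_n -> pt -> C.
Variable e : 'I_n -> pt -> C.
Variable E : 'I_n -> pt -> C.
Variable d : C.

Definition cl (i j k : 'I_n) (u : pt) : C := \sum_(m < n) c i j m u * etal u m k.

Definition nabla_c (l i j k : 'I_n) (u : pt) : C :=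
  pd (cl i j k) l u
  - \sum_(m < n) (Chr m l i u * cl m j k u + Chr m l j u * cl i m k u
                  + Chr m l k u * cl i j m u).

Definition LE_c (i j k : 'I_n) (u : pt) : C :=
  \sum_(l < n) (E l u * pd (c i j k) l u - c i j l u * pd (E k) l u
                + c l j k u * pd (E l) i u + c i l k u * pd (E l) j u).

Definition LE_eta (i j : 'I_n) (u : pt) : C :=
  \sum_(l < n) (E l u * pd (fun v => etal v i j) l u
                + etal u l j * pd (E l) i u + etal u i l * pd (E l) j u).

(* intersection form (E o) eta^{-1}:  g^{mj} = sum_{k,l} E^k c^m_{kl} eta^{lj} *)
Definition intersection_form (u : pt) : 'M[C]_n :=
  \matrix_(m, j) \sum_(k < n) \sum_(l < n) E k u * c k l m u * eta u l j.

Definition DubrovinFrobenius (U : set pt) : Prop :=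
  open U /\
  (forall u, U u ->
     [/\ (eta u)^T = eta u, \det (eta u) != 0
       & forall (l i j k : 'I_n), Riem l i j k u = 0]) /\
  (forall (i j : 'I_n), holo_on U (fun v => eta v i j)) /\
  (forall (i j k : 'I_n), holo_on U (c i j k)) /\
  (forall (i : 'I_n), holo_on U (e i)) /\
  (forall (i : 'I_n), holo_on U (E i)) /\
  (forall u, U u ->
     (forall (i j k : 'I_n), c i j k u = c j i k u) /\
     (forall (i j k l : 'I_n), \sum_(m < n) c i j m u * c m k l u
                      = \sum_(m < n) c j k m u * c i m l u) /\
     (forall (i j k : 'I_n), \sum_(l < n) c i j l u * etal u l k
                    = \sum_(l < n) c j k l u * etal u i l) /\
     (forall (j k : 'I_n), \sum_(i < n) e i u * c i j k u = ((j == k) : nat)%:R) /\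
     (forall (i k : 'I_n), pd (e k) i u + \sum_(j < n) Chr k i j u * e j u = 0) /\
     (forall (l i j k : 'I_n), nabla_c l i j k u = nabla_c i l j k u) /\
     (forall (k : 'I_n), \sum_(i < n) (e i u * pd (E k) i u - E i u * pd (e k) i u) = e k u) /\
     (forall (i j k : 'I_n), LE_c i j k u = c i j k u) /\
     (forall (i j : 'I_n), LE_eta i j u = (2 - d) * etal u i j)).

End FrobDefs.

(* Main.v *)
Require Import Defs.
From HB Require Import structures.
From mathcomp Require Import all_boot all_order all_algebra.
From mathcomp Require Import all_classical all_reals all_analysis.
From mathcomp Require Import complex.
From mathcomp Require Import zify ring lra.
Import Order.TTheory GRing.Theory Num.Theory.
Import numFieldTopology.Exports numFieldNormedType.Exports.
Local Open Scope ring_scope.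

Set Implicit Arguments. Unset Strict Implicit. Unset Printing Implicit Defensive.

(* The structure is the Landau-Ginzburg one with superpotential
   lambda(z) = P(z)/z, where P(z) = prod_a (z + p_a^2) = sum_k u_k z^(n-k).
   Put Q(z) = z^2 lambda'(z) = z P'(z) - P(z).  Since Q(0) = -u_n <> 0, sending
   d/du_k to d lambda/du_k = z^(n-k-1) identifies the tangent space with
   C[z,1/z]/(Q), whose product is the Frobenius product; the unit is 1 = d/du_(n-1)
   and E acts as multiplication by lambda.  The cometric eta is the Bezoutian of Q
   divided by n-1, and its inverse pairs f and h to n-1 times the coefficient of 1/z
   in the expansion of fh/lambda' at infinity: both are Hankel matrices, one in the
   coefficients of Q, the other in the coefficients h_m of z^(-m-1) in the expansion
   of 1/Q at infinity.  Writing HH = h * h (Cauchy product), one has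
   dh_m/du_(n-c) = (1 - c) HH_(m+c-1), and the Christoffel symbols, in the
   coordinates u_(n-a), are Gamma^c_ab = - c h_(a+b-c-1).  Flatness and the symmetry
   of nabla c then come from the identity 2 sum_p p h_p h_(s-p) = s HH_s. *)

(** * Cauchy products of sequences *)

Section Convolution.
Variable F : comNzRingType.
Implicit Types f g h : nat -> F.

Definition conv f g (k : nat) : F := \sum_(i < k.+1) f i * g (k - i)%N.

(** Truncation at any N > k leaves the k-th coefficient unchanged, so commutativity and
    associativity of [conv] come from those of polynomials. *)
Lemma conv_coef f g N k : (k < N)%N ->
  conv f g k = ((\poly_(i < N) f i) * (\poly_(i < N) g i))`_k.
Proof.
move=> kN; rewrite coefM; apply: eq_bigr => i _; rewrite !coef_poly.
have iN : (i < N)%N by have := ltn_ord i; lia.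
have kiN : (k - i < N)%N by lia.
by rewrite iN kiN.
Qed.

Lemma eq_conv f f' g g' k : (forall i, (i <= k)%N -> f i = f' i) ->
  (forall i, (i <= k)%N -> g i = g' i) -> conv f g k = conv f' g' k.
Proof.
move=> ff gg; apply: eq_bigr => i _; rewrite ff ?gg //; first by lia.
by have := ltn_ord i; lia.
Qed.

Lemma convC f g k : conv f g k = conv g f k.
Proof. by rewrite !(conv_coef _ _ (ltnSn k)) mulrC. Qed.

Lemma convA f g h k : conv f (conv g h) k = conv (conv f g) h k.
Proof.
have E f' g' i : (i <= k)%N -> conv f' g' i =
    ((\poly_(j < k.+1) f' j) * (\poly_(j < k.+1) g' j))`_i.
  by move=> ik; rewrite -conv_coef.
rewrite (eq_conv (f' := f) (g' := fun i =>
  ((\poly_(j < k.+1) g j) * (\poly_(j < k.+1) h j))`_i)) //; last exact: E.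
rewrite [RHS](eq_conv (g' := h) (f' := fun i =>
  ((\poly_(j < k.+1) f j) * (\poly_(j < k.+1) g j))`_i)) //; last exact: E.
pose p := \poly_(j < k.+1) f j; pose q := \poly_(j < k.+1) g j.
pose r := \poly_(j < k.+1) h j.
transitivity ((p * (q * r))`_k).
  rewrite coefM; apply: eq_bigr => i _; rewrite coef_poly ltn_ord //.
rewrite mulrA coefM; apply: eq_bigr => i _; rewrite [r`_ _]coef_poly.
by have -> : (k - i < k.+1)%N by lia.
Qed.

Lemma conv_delta f m k : conv (fun i => (i == m)%:R) f k =
  if (m <= k)%N then f (k - m)%N else 0.
Proof.
case: leqP => mk.
  rewrite /conv (bigD1 (inord m)) //= inordK ?ltnS // eqxx mul1r big1 ?addr0 //.
  move=> i /eqP neq; case: eqP => [im|_]; last by rewrite mul0r.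
  by case: neq; apply: val_inj; rewrite /= inordK ?ltnS // im.
rewrite /conv big1 // => i _; have := ltn_ord i.
by case: eqP => [->|]; rewrite ?mul0r //; lia.
Qed.

(* Change of variable m + b = p + a between two windows of summation. *)
Lemma sum_shift (n N a b : nat) (K L : nat -> F) :
  (forall m p, (m < n)%N -> (p < N)%N -> (m + b = p + a)%N -> K m = L p) ->
  (forall m, (m < n)%N -> (forall p, (p < N)%N -> (m + b != p + a)%N) -> K m = 0) ->
  (forall p, (p < N)%N -> (forall m, (m < n)%N -> (m + b != p + a)%N) -> L p = 0) ->
  \sum_(m < n) K m = \sum_(p < N) L p.
Proof.
move=> KL K0 L0.
transitivity (\sum_(m < n) \sum_(p < N | (m + b == p + a)%N) K m).
  apply: eq_bigr => m _.
  case: (pickP (fun p : 'I_N => (m + b == p + a)%N)) => [p mp|no].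
    rewrite (big_pred1 p) // => p' /=; apply/idP/eqP => [mp'|->] //.
    by apply: val_inj; move/eqP: mp; move/eqP: mp' => /=; lia.
  rewrite big_pred0 // K0 // => p pN; exact/negbT/(no (Ordinal pN)).
rewrite (exchange_big_dep predT) //=; apply: eq_bigr => p _.
case: (pickP (fun m : 'I_n => (m + b == p + a)%N)) => [m mp|no].
  rewrite (big_pred1 m) => [|m' /=]; first exact/KL/eqP.
  apply/idP/eqP => [mp'|->] //.
  by apply: val_inj; move/eqP: mp; move/eqP: mp' => /=; lia.
rewrite big_pred0 // L0 // => m mn; exact/negbT/(no (Ordinal mn)).
Qed.

(** Averaging with the reversed sum i -> k - i replaces the weight i by k/2. *)
Lemma sum_weighted_selfconv f k :
  2 * \sum_(i < k.+1) i%:R * (f i * f (k - i)%N) = k%:R * conv f f k.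
Proof.
rewrite mulr2n mulrDl mul1r {2}(reindex_inj rev_ord_inj) /= -big_split mulr_sumr.
apply: eq_bigr => i _ /=; rewrite subSS.
have ik : (i <= k)%N by have := ltn_ord i.
by rewrite subKn // natrB // (mulrC (f (k - i)%N)); ring.
Qed.

End Convolution.

(** * Coefficients of Q and 1/Q, and multiplication modulo Q *)

Section Resolvent.
Variables (F : numFieldType) (n : nat).
Hypothesis hn : (2 <= n)%N.
Implicit Types (u : 'rV[F]_n) (k m i j a b c s t : nat).

(* [u_k] with the paper's indexing: [u_0 = 1], and [u_k = 0] for [k > n] *)
Definition uc u k : F := if k is l.+1 then oapp (u 0) 0 (insub l : option 'I_n) else 1.

Lemma uc_gt u k : (n < k)%N -> uc u k = 0.
Proof. by case: k => // k nk; rewrite /uc insubF //; lia. Qed.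

Lemma uc_ord u (i : 'I_n) : uc u i.+1 = u 0 i.
Proof. by rewrite /uc valK. Qed.

(* coefficient of z^(n-k) in Q(z) = z P'(z) - P(z) *)
Definition qh u k : F := (n.-1%:R - k%:R) * uc u k.

(* [hc u k] is the coefficient of z^(-k-1) in the expansion of 1/Q at infinity;
   [hseq u k] lists the first [k] of these. *)
Fixpoint hseq u k : seq F :=
  if k is l.+1 then
    let s := hseq u l in
    rcons s (n.-1%:R^-1 * ((l == n.-1)%:R - \sum_(i < l) qh u (l - i)%N * s`_i))
  else [::].

Definition hc u k : F := (hseq u k.+1)`_k.

Lemma size_hseq u k : size (hseq u k) = k.
Proof. by elim: k => //= k IH; rewrite size_rcons IH. Qed.

Lemma nth_hseq u k i : (i < k)%N -> (hseq u k)`_i = hc u i.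
Proof.
elim: k => // k IH; rewrite ltnS leq_eqVlt => /orP[/eqP -> //|ik].
by rewrite /= nth_rcons size_hseq ik IH.
Qed.

Lemma hc_rec u k :
  hc u k = n.-1%:R^-1 * ((k == n.-1)%:R - \sum_(i < k) qh u (k - i)%N * hc u i).
Proof.
rewrite /hc /= nth_rcons size_hseq ltnn eqxx; congr (_ * (_ - _)).
by apply: eq_bigr => i _; rewrite nth_hseq.
Qed.

Lemma n1_neq0 : n.-1%:R != 0 :> F.
Proof. by rewrite pnatr_eq0; lia. Qed.

(** This is Q (1/Q) = 1, read at the coefficient of z^(n-1-k). *)
Lemma qh_hc u k : conv (qh u) (hc u) k = (k == n.-1)%:R.
Proof.
rewrite convC /conv big_ord_recr /= subnn {2}/qh subr0 mulr1 hc_rec mulrAC.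
rewrite mulVf ?n1_neq0 // mul1r addrC.
under [X in _ + X]eq_bigr => i _ do rewrite mulrC.
by rewrite subrK.
Qed.

Lemma hc_small u k : (k < n.-1)%N -> hc u k = 0.
Proof.
elim/ltn_ind: k => k IH kn; rewrite hc_rec (_ : (k == n.-1) = false); last by lia.
rewrite big1 ?subr0 ?mulr0 // => i _.
by rewrite IH ?mulr0 //; have := ltn_ord i; lia.
Qed.

Lemma hc_n1 u : hc u n.-1 = n.-1%:R^-1.
Proof.
rewrite hc_rec eqxx big1 ?subr0 ?mulr1 // => i _.
by rewrite hc_small ?mulr0.
Qed.

(** [HH u s] is the coefficient of z^(-s-2) in the expansion of 1/Q^2 at infinity. *)
Definition HH u := conv (hc u) (hc u).

Lemma HH_small u s : (s < 2 * n.-1)%N -> HH u s = 0.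
Proof.
move=> sn; rewrite /HH /conv big1 // => i _; have := ltn_ord i => ik.
have [lti|lei] := ltnP i n.-1; first by rewrite hc_small ?mul0r.
by rewrite [hc u (s - i)]hc_small ?mulr0 //; lia.
Qed.

Lemma qh_HH u k : conv (qh u) (HH u) k = if (n.-1 <= k)%N then hc u (k - n.-1)%N else 0.
Proof.
rewrite convA (eq_conv (f' := fun i => (i == n.-1)%:R) (g' := hc u)) //.
  by rewrite conv_delta.
by move=> i _; rewrite qh_hc.
Qed.

(* coefficient of z^m in Q *)
Definition qz u m : F := if (m <= n)%N then qh u (n - m)%N else 0.

Lemma qzE u m : (m <= n)%N -> qz u m = (m%:R - 1) * uc u (n - m)%N.
Proof.
move=> mn; rewrite /qz mn /qh natrB //; congr (_ * _).
have -> : n%:R = n.-1%:R + 1 :> F by rewrite natr1 prednK //; lia.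
by ring.
Qed.

Lemma qz_gt u m : (n < m)%N -> qz u m = 0.
Proof. by rewrite /qz ltnNge => /negbTE ->. Qed.

Lemma qh_gt u k : (n < k)%N -> qh u k = 0.
Proof. by move=> nk; rewrite /qh uc_gt ?mulr0. Qed.

(** Inverts the Hankel matrix of Q. Each entry is a coefficient of Q (1/Q); the terms outside the
    window have an h of index below n-1 or a coefficient of Q of degree above n. *)
Lemma qz_hc u a c : (a < n)%N -> (c < n)%N ->
  \sum_(b < n) qz u (a + b).+1 * hc u (b + c) = (a == c)%:R.
Proof.
move=> an cn; have -> : (a == c) = ((n.-1 - a + c)%N == n.-1) by lia.
rewrite -(qh_hc u) convC.
rewrite /conv; apply: (@sum_shift _ _ _ 0 c
   (fun b => qz u (a + b).+1 * hc u (b + c))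
   (fun i => hc u i * qh u (n.-1 - a + c - i)%N)).
- move=> b i bn iN; rewrite addn0 => ei; subst i.
  rewrite /qz; have -> : ((a + b).+1 <= n)%N by lia.
  by rewrite mulrC; congr (hc u _ * qh u _); lia.
- move=> b bn H; rewrite qz_gt ?mul0r //; rewrite ltnNge; apply/negP => le.
  have /H : (b + c < (n.-1 - a + c).+1)%N by lia.
  by rewrite addn0 eqxx.
- move=> i iN H; have ic : (i < c)%N.
    rewrite ltnNge; apply/negP => le; have /H : (i - c < n)%N by lia.
    by rewrite addn0 subnK // eqxx.
  by rewrite hc_small ?mul0r //; lia.
Qed.

Lemma qz_hc_rec u j : \sum_(b < n.+1) qz u b * hc u (b + j) = 0.
Proof.
transitivity (conv (qh u) (hc u) (j + n)%N); last first.
  by rewrite qh_hc (_ : _ == _ = false) //; lia.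
rewrite convC /conv; apply: (@sum_shift _ _ _ 0 j
   (fun b => qz u b * hc u (b + j))
   (fun i => hc u i * qh u (j + n - i)%N)).
- move=> b i bn iN; rewrite addn0 => ei; subst i.
  rewrite /qz; have -> : (b <= n)%N by lia.
  by rewrite mulrC; congr (hc u _ * qh u _); lia.
- move=> b bn H; have /H : (b + j < (j + n).+1)%N by lia.
  by rewrite addn0 eqxx.
- move=> i iN H; have ic : (i < j)%N.
    rewrite ltnNge; apply/negP => le; have /H : (i - j < n.+1)%N by lia.
    by rewrite addn0 subnK // eqxx.
  by rewrite qh_gt ?mulr0 //; lia.
Qed.

(* [mu u s] and [nu u s] are the sums over the zeros of Q of the residues of
   z^(s-1)/Q and z^(s-2)/Q; for exponents >= 0 only infinity contributes. *)
Definition mu u s : F := if s is t.+1 then hc u t else (uc u n)^-1.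
Definition nu u s : F := if s is t.+1 then mu u t else 0.

Lemma qz0 u : qz u 0 = - uc u n.
Proof. by rewrite qzE // subn0 sub0r mulN1r. Qed.

Lemma qz1 u : qz u 1 = 0.
Proof. by rewrite qzE ?subrr ?mul0r //; lia. Qed.

Lemma qzn u : qz u n = n.-1%:R.
Proof. by rewrite /qz leqnn subnn /qh mulr1 subr0. Qed.

(** Extends the recurrence [qz_hc_rec] two steps down. At j = 0 it holds because Q has no linear
    term; at j = 1 the end terms contribute -u_n / u_n = -1 and (n-1) h_(n-1) = 1. *)
Lemma qz_nu u j : uc u n != 0 -> \sum_(b < n.+1) qz u b * nu u (b + j) = 0.
Proof.
move=> un0; case: j => [|[|j]].
- rewrite big1 // => -[[|[|b]] bn] _ /=; first by rewrite mulr0.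
    by rewrite qz1 mul0r.
  by rewrite addn0 hc_small ?mulr0 //; lia.
- rewrite (bigD1 ord0) //= (bigD1 ord_max) /=; last first.
    by apply/eqP => /(congr1 val) /=; lia.
  rewrite big1 => [|[[|b] bn] /andP[/eqP b0 /eqP bmax]]; last first.
  + rewrite addn1 /= hc_small ?mulr0 //.
    have bn' : b.+1 <> n by move=> e; apply: bmax; apply: val_inj.
    by lia.
  + by case: b0; apply: val_inj.
  rewrite addr0 addn1 qz0 qzn mulNr divff //=.
  have -> : mu u n = hc u n.-1 by rewrite -{1}(@prednK n) //; lia.
  by rewrite hc_n1 divff ?n1_neq0 // addNr.
- under eq_bigr => b _ do rewrite !addnS /=.
  exact: qz_hc_rec.
Qed.

(** The extreme coefficients n-1 and -u_n of Q are invertible, so the recurrence runs both ways: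
    forward beyond n, and one step back to index 0. *)
Lemma lin_rec_zero u (X : nat -> F) : uc u n != 0 ->
  (forall j, \sum_(b < n.+1) qz u b * X (b + j)%N = 0) ->
  (forall j, (0 < j <= n)%N -> X j = 0) -> forall j, X j = 0.
Proof.
move=> un0 rec X0; elim/ltn_ind => j IH.
have [jn|nj] := leqP j n; last first.
  have := rec (j - n)%N; rewrite big_ord_recr /= big1 => [|b _]; last first.
    by rewrite IH ?mulr0 //; have := ltn_ord b; lia.
  rewrite add0r subnKC ?(ltnW nj) // qzn => /eqP.
  by rewrite mulf_eq0 (negbTE n1_neq0) => /eqP.
case: j IH jn => [_ _|j _ jn]; last by apply: X0; lia.
have := rec 0%N; rewrite big_ord_recl /= big1 => [|b _]; last first.
  by rewrite X0 ?mulr0 // /bump /=; have := ltn_ord b; lia.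
rewrite addr0 addn0 qz0 => /eqP.
by rewrite mulf_eq0 oppr_eq0 (negbTE un0) => /eqP.
Qed.

(* z^(s-2) = sum_c cs s c * z^(c-1) modulo Q *)
Definition cs u s c : F := \sum_(d < n) qz u (c + d).+1 * mu u (s + d).

(** Pairs z^(s-2) and its reduction modulo Q with z^j. Both sides satisfy the recurrence in j, so
    the window 1..n suffices, and there the identity is the Hankel inversion [qz_hc]. *)
Lemma cs_nu u s j : uc u n != 0 ->
  \sum_(c < n) cs u s c * nu u (c + j).+1 = nu u (s + j).
Proof.
move=> un0; apply/eqP; rewrite -subr_eq0; apply/eqP; move: j.
apply: (lin_rec_zero un0) => [j|j jn].
  under eq_bigr => b _ do rewrite mulrBr mulr_sumr.
  rewrite sumrB exchange_big /=.
  under [X in _ - X]eq_bigr => b _ do rewrite addnCA.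
  rewrite qz_nu // subr0 big1 // => c _.
  transitivity (cs u s c * \sum_(b < n.+1) qz u b * nu u (b + (c + j).+1)).
    rewrite mulr_sumr; apply: eq_bigr => b _.
    by rewrite addnS /= (addnCA b); ring.
  by rewrite qz_nu // mulr0.
case: j jn => // j /andP[_ jn].
under eq_bigr => c _ do rewrite /cs mulr_suml.
rewrite exchange_big /= [X in X - _](_ : _ = nu u (s + j.+1)) ?subrr //.
transitivity (\sum_(d < n) mu u (s + d) * (nat_of_ord d == j)%:R).
  apply: eq_bigr => d _; rewrite -(@qz_hc u d j) // mulr_sumr.
  apply: eq_bigr => c _; rewrite addnS /= (addnC d); ring.
rewrite (bigD1 (Ordinal jn)) //= eqxx mulr1 big1 ?addr0; first by rewrite addnS.
by move=> d /eqP dj; case: eqP => [e|]; rewrite ?mulr0 //; case: dj; apply: val_inj.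
Qed.

(** The right-hand side is the coefficient of z^(l-1) in z^(i+j+k-3) modulo Q. It depends only on i
    + j + k, which gives associativity. *)
Lemma cs_assoc u i j k l : uc u n != 0 ->
  \sum_(m < n) cs u (i + j) m * cs u (m + k) l =
  \sum_(d < n) qz u (l + d).+1 * nu u (i + j + k + d).
Proof.
move=> un0; under eq_bigr => m _ do rewrite [cs u (m + k) l]/cs mulr_sumr.
rewrite exchange_big /=; apply: eq_bigr => d _.
rewrite -addnA -cs_nu // mulr_sumr; apply: eq_bigr => m _.
by rewrite /= -addnA; ring.
Qed.

Lemma cs_hc u s c : uc u n != 0 -> (c < n)%N ->
  \sum_(m < n) cs u s m * hc u (m + c) = mu u (s + c).
Proof.
move=> un0 cn; have := cs_nu s c.+1 un0; rewrite !addnS /=.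
by under eq_bigr do rewrite addnS /=.
Qed.

(** For s = b + 1 the power z^(s-2) is already the basis vector z^(b-1). *)
Lemma cs_unit u b c : (b < n)%N -> (c < n)%N -> cs u b.+1 c = (c == b)%:R.
Proof.
move=> bn cn; rewrite -(qz_hc u cn bn) /cs; apply: eq_bigr => d _.
by rewrite addSn /= (addnC b).
Qed.

End Resolvent.

(** * Windowed quadratic sums in the h_m *)

Section HankelSums.
Variables (F : numFieldType) (n : nat).
Hypothesis hn : (2 <= n)%N.
Implicit Types (u : 'rV[F]_n) (k m i j a b c d s t x y : nat).

(** Truncated differences such as [s - c.+1] fall back to index 0; since h vanishes there, such
    out-of-range terms drop out. *)
Let hc0 u : hc u 0 = 0.
Proof. by rewrite hc_small //; lia. Qed.

Lemma sum_affine_selfconv u N (r : F) :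
  2 * \sum_(p < N.+1) (p%:R + r) * (hc u p * hc u (N - p)) = (N%:R + 2 * r) * HH u N.
Proof.
under eq_bigr => p _ do rewrite mulrDl.
rewrite big_split mulrDr sum_weighted_selfconv -mulr_sumr /=.
by rewrite -[\sum_(i < _) _]/(HH u N) -/(HH u N); ring.
Qed.

Lemma hc_window_sum u s d : (d < n)%N -> (s <= 2 * n.-1)%N ->
  2 * \sum_(c < n) hc u (c + d) * (c%:R * hc u (s - c.+1)) =
  (s%:R - 1 - d%:R) * HH u (s + d).-1.
Proof.
move=> dn sn; set N := (s + d).-1.
rewrite (@sum_shift _ n N.+1 0 d (fun c => hc u (c + d) * (c%:R * hc u (s - c.+1)))
   (fun p => (p%:R - d%:R) * (hc u p * hc u (N - p)))); first last.
- move=> p pN H; have [pn|np] := ltnP p n.-1; first by rewrite (hc_small hn _ pn) mul0r mulr0.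
  rewrite (@hc_small _ _ hn _ (N - p)) ?mulr0 //.
  rewrite ltnNge; apply/negP => le; have /H : (p - d < n)%N by lia.
  by rewrite addn0 subnK ?eqxx //; lia.
- move=> c cn H; rewrite (_ : s - c.+1 = 0)%N ?hc0 ?mulr0 //.
  apply/eqP; rewrite -leqn0 leqNgt; apply/negP => lt.
  have /H : (c + d < N.+1)%N by lia.
  by rewrite addn0 eqxx.
- move=> c p cn pN; rewrite addn0 => e; subst p.
  rewrite natrD addrK (_ : s - c.+1 = N - (c + d))%N; last by lia.
  by rewrite mulrCA.
rewrite sum_affine_selfconv.
(* If N is small, [HH] vanishes and the scalar factor is irrelevant; otherwise the subtraction
   defining N is not truncated. *)
have [small|big] := ltnP N (2 * n.-1); first by rewrite HH_small ?mulr0.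
have -> : s%:R = N%:R + 1 - d%:R :> F by rewrite natr1 -natrB; [congr _%:R|]; lia.
by ring.
Qed.

(** Evaluates the products of Christoffel symbols in the curvature, by the substitution p = j + m -
    l - 1. *)
Lemma chr_product_sum u i j k l : (i < n)%N -> (j < n)%N -> (k < n)%N -> (l < n)%N ->
  2 * \sum_(m < n) (l%:R * hc u (j + m - l.+1)) * (m%:R * hc u (k + i - m.+1)) =
  l%:R * (i%:R + k%:R + l%:R - j%:R) * HH u (i + j + k - l.+2).
Proof.
move=> iln jn kn ln; set N := (i + j + k - l.+2)%N.
under eq_bigr => m _ do rewrite -mulrA.
rewrite -mulr_sumr mulrCA -mulrA; congr (_ * _).
rewrite (@sum_shift _ n N.+1 l.+1 j
   (fun m => hc u (j + m - l.+1) * (m%:R * hc u (k + i - m.+1)))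
   (fun p => (p%:R + (l.+1%:R - j%:R)) * (hc u p * hc u (N - p)))); first last.
- move=> p pN H; have [pn|np] := ltnP p n.-1; first by rewrite (hc_small hn _ pn) mul0r mulr0.
  rewrite (@hc_small _ _ hn _ (N - p)) ?mulr0 //.
  rewrite ltnNge; apply/negP => le; have /H : (p + l.+1 - j < n)%N by lia.
  by rewrite subnK ?eqxx //; lia.
- move=> m mn H; have [le|gt] := leqP (j + m) l.
    by rewrite (_ : j + m - l.+1 = 0)%N ?hc0 ?mul0r //; lia.
  rewrite (_ : k + i - m.+1 = 0)%N ?hc0 ?mulr0 //.
  apply/eqP; rewrite -leqn0 leqNgt; apply/negP => lt.
  have /H : (j + m - l.+1 < N.+1)%N by lia.
  by rewrite subnK ?(addnC j) ?eqxx //; lia.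
- move=> m p mn pN e; have -> : (j + m - l.+1 = p)%N by lia.
  have [pn|np] := ltnP p n.-1; first by rewrite (hc_small hn _ pn) !mul0r mulr0.
  rewrite (_ : k + i - m.+1 = N - p)%N; last by lia.
  rewrite mulrCA; congr (_ * _); rewrite addrA -natrD -e natrD addrK //.
rewrite sum_affine_selfconv.
have [small|big] := ltnP N (2 * n.-1); first by rewrite HH_small ?mulr0.
have -> : N%:R = i%:R + j%:R + k%:R - l%:R - 2 :> F.
  rewrite -!natrD -addrA -opprD -natrD -natrB; first by congr _%:R; lia.
  by lia.
by rewrite -natr1; ring.
Qed.

(** Up to the factor n-1, a correction term of nabla c: x adds the two lower indices of the
    Christoffel symbol, y the other two indices. *)
Definition Bsum u x y : F := \sum_(m < n) m%:R * hc u (x - m.+1) * mu u (m + y).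

(** Here p = m + y - 1. The weight m kills the term m = 0, the only one in which [mu] can be 1/u_n;
    the truncated weight likewise discards p + 1 < y. *)
Lemma BsumE u x y : (x <= 2 * n.-1)%N ->
  Bsum u x y = \sum_(p < (x + y - 2).+1)
    (p.+1 - y)%:R * (hc u p * hc u (x + y - 2 - p)).
Proof.
move=> xn; set N := (x + y - 2)%N.
apply: (@sum_shift _ n N.+1 1 y (fun m => m%:R * hc u (x - m.+1) * mu u (m + y))
   (fun p => (p.+1 - y)%:R * (hc u p * hc u (N - p)))).
- move=> m p mn pN e; have -> : (p.+1 - y = m)%N by lia.
  case: (posnP m) => [->|m0]; first by rewrite !mul0r.
  rewrite e addn1 /= -mulrA; congr (_ * _).
  have [pn|np] := ltnP p n.-1; first by rewrite (hc_small hn _ pn) mul0r mulr0.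
  by rewrite mulrC (_ : x - m.+1 = N - p)%N //; lia.
- move=> m mn H; case: (posnP m) => [->|m0]; first by rewrite !mul0r.
  rewrite (_ : x - m.+1 = 0)%N ?hc0 ?mulr0 ?mul0r //.
  apply/eqP; rewrite -leqn0 leqNgt; apply/negP => lt.
  have /H : (m + y - 1 < N.+1)%N by lia.
  by rewrite subnK ?eqxx //; lia.
- move=> p pN H; have [lt|ge] := ltnP p.+1 y.
    by rewrite (_ : p.+1 - y = 0)%N ?mul0r //; lia.
  rewrite (@hc_small _ _ hn _ (N - p)) ?mulr0 //.
  rewrite ltnNge; apply/negP => le; have /H : (p.+1 - y < n)%N by lia.
  by rewrite subnK ?addn1 ?eqxx //; lia.
Qed.

(** After reversal of the second sum, the two truncated weights are the positive and negative parts
    of p + 1 - y; only their difference is affine in p. *)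
Lemma Bsum_antisym u x y : (x <= 2 * n.-1)%N -> (y <= 2 * n.-1)%N ->
  2 * (Bsum u x y - Bsum u y x) = (x%:R - y%:R) * HH u (x + y - 2).
Proof.
move=> xn yn; rewrite !BsumE // (addnC y); set N := (x + y - 2)%N.
rewrite [X in _ - X](reindex_inj rev_ord_inj) /= -sumrB.
transitivity (2 * \sum_(p < N.+1) (p%:R + (1 - y%:R)) * (hc u p * hc u (N - p))).
  congr (2 * _); apply: eq_bigr => p _; have := ltn_ord p => pN.
  rewrite subSS (subKn (_ : p <= N)%N) // [hc u (N - p) * _]mulrC -mulrBl.
  have [pn|np] := ltnP p n.-1; first by rewrite (hc_small hn _ pn) !mul0r !mulr0.
  congr (_ * _); rewrite addrA natr1.
  have [le|gt] := leqP y p.+1.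
    by rewrite (_ : (N - p).+1 - x = 0)%N ?subr0 ?natrB //; lia.
  rewrite (_ : p.+1 - y = 0)%N ?sub0r; last by lia.
  rewrite (_ : (N - p).+1 - x = y - p.+1)%N ?natrB ?opprB //; lia.
rewrite sum_affine_selfconv.
have [small|big] := ltnP N (2 * n.-1); first by rewrite HH_small ?mulr0.
have -> : N%:R = x%:R + y%:R - 2 :> F by rewrite -natrD -natrB //; lia.
by ring.
Qed.

End HankelSums.

(** * Bezoutians and residues for P and Q *)

Section SuperpotentialPolynomials.
Variables (F : numFieldType) (n : nat).
Hypothesis hn : (2 <= n)%N.
Implicit Types (u : 'rV[F]_n) (k m i j a b c d s t x y : nat) (p q r : {poly F}).

Definition Ppol u : {poly F} := \poly_(m < n.+1) uc u (n - m).
Definition Qpol u : {poly F} := 'X * (Ppol u)^`() - Ppol u.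

Lemma coef_Ppol u m : (Ppol u)`_m = if (m <= n)%N then uc u (n - m) else 0.
Proof. by rewrite coef_poly ltnS. Qed.

Lemma coef_Qpol u m : (Qpol u)`_m = qz u m.
Proof.
rewrite coefB coefXM; have [mn|nm] := leqP m n; last first.
  rewrite qz_gt //; case: m nm => //= m nm.
  by rewrite coef_deriv coef_Ppol leqNgt nm mul0rn subrr.
rewrite qzE //; case: m mn => [|m] mn /=.
  by rewrite coef_Ppol leq0n mulrBl mul0r mul1r.
by rewrite coef_deriv coef_Ppol mn mulrBl mul1r mulr_natl.
Qed.

Lemma size_Ppol u : (size (Ppol u) <= n.+1)%N.
Proof. exact: size_poly. Qed.

Lemma size_dPpol u : (size (Ppol u)^`() <= n)%N.
Proof.
apply/leq_sizeP => j nj; rewrite coef_deriv coef_Ppol leqNgt ltnS nj.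
by rewrite mul0rn.
Qed.

Lemma size_Qpol u : (size (Qpol u) <= n.+1)%N.
Proof. by apply/leq_sizeP => j nj; rewrite coef_Qpol qz_gt. Qed.

(* sum_j Ghat_j(z) w^j = P'(z) P'(w) - (P'(z) P(w) - P(z) P'(w)) / (w - z), where
   [drop_poly j.+1 F] is the coefficient of w^j in (F(w) - F(z)) / (w - z) *)
Definition Ghat u j : {poly F} :=
  (Ppol u)^`()`_j *: (Ppol u)^`() -
  ((Ppol u)^`() * drop_poly j.+1 (Ppol u) - Ppol u * drop_poly j.+1 (Ppol u)^`()).

(* Splitting P and P' at degree j, the products of high parts cancel. *)
Lemma size_Ghat u j : (j < n)%N -> (size (Ghat u j) <= n)%N.
Proof.
move=> jn; rewrite /Ghat; set P := Ppol u; set k := j.+1.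
have -> : P^`() * drop_poly k P - P * drop_poly k P^`() =
    take_poly k P^`() * drop_poly k P - take_poly k P * drop_poly k P^`().
  have takeE p : take_poly k p = p - drop_poly k p * 'X^k.
    by rewrite -{2}(poly_take_drop k p) addrK.
  by rewrite !takeE; ring.
apply: (leq_trans (size_polyD _ _)); rewrite geq_max size_polyN.
rewrite (leq_trans (size_scale_leq _ _)) ?size_dPpol //=.
apply: (leq_trans (size_polyD _ _)); rewrite geq_max size_polyN.
have bnd q r N : (size r <= N)%N -> (k <= N <= n.+1)%N ->
    (size (take_poly k q * drop_poly k r)%R <= n)%N.
  move=> rN /andP[kN Nn].
  apply: (leq_trans (size_polyMleq _ _)).
  rewrite size_drop_poly; have := size_take_poly k q; lia.
rewrite (bnd _ _ n.+1) ?size_Ppol //=; last by rewrite /k; lia.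
by rewrite (bnd _ _ n) ?size_dPpol // /k; lia.
Qed.

Lemma drop_polyXM k p : drop_poly k.+1 ('X * p) = drop_poly k p.
Proof. by apply/polyP => i; rewrite !coef_drop_poly coefXM addnS. Qed.

Lemma drop_polyS k p : drop_poly k p = (p`_k)%:P + 'X * drop_poly k.+1 p.
Proof.
apply/polyP => i; rewrite coefD coefC coefXM !coef_drop_poly.
by case: i => [|i] /=; rewrite ?addr0 ?add0r // addSnnS.
Qed.

Lemma drop_Qpol u j :
  drop_poly j.+1 (Qpol u) = drop_poly j (Ppol u)^`() - drop_poly j.+1 (Ppol u).
Proof. by rewrite /Qpol -scaleN1r drop_polyD drop_polyZ drop_polyXM scaleN1r. Qed.

(** The terms in [drop_poly j.+1] of P' collect into z P' - P = Q. With the bound [size_Ghat], this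
    makes Ghat_j the remainder of the left-hand side modulo Q for j < n. *)
Lemma dPpol_Bezout u j : (Ppol u)^`() * drop_poly j.+1 (Qpol u) =
  Ghat u j + Qpol u * drop_poly j.+1 (Ppol u)^`().
Proof. by rewrite drop_Qpol drop_polyS /Ghat /Qpol -mul_polyC; ring. Qed.

(* F |-> sum over the zeros of Q of the residue of z^(t-2) F / Q *)
Definition resQ u t p : F := \sum_(s < size p) p`_s * nu u (s + t).

Lemma resQ_wide u t p N : (size p <= N)%N -> resQ u t p = \sum_(s < N) p`_s * nu u (s + t).
Proof.
move=> pN; rewrite /resQ (big_ord_widen N (fun s => p`_s * nu u (s + t))) //.
rewrite big_mkcond; apply: eq_bigr => s _.
by case: ltnP => // le; rewrite nth_default ?mul0r.
Qed.

Lemma resQ_linear u t : linear_for *%R (resQ u t).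
Proof.
move=> a p q; pose N := maxn (size p) (maxn (size q) (size (a *: p + q))).
rewrite !(@resQ_wide _ _ _ N) ?leq_max ?leqnn ?orbT // mulr_sumr -big_split /=.
by apply: eq_bigr => s _; rewrite coefD coefZ mulrDl mulrA.
Qed.
HB.instance Definition _ u t := GRing.isLinear.Build F {poly F} F *%R (resQ u t) (@resQ_linear u t).

Lemma resQ_MXn u t i p : resQ u t (p * 'X^i) = resQ u (t + i) p.
Proof.
rewrite (@resQ_wide _ _ (p * 'X^i) (i + size p)); last first.
  by apply: (leq_trans (size_polyMleq _ _)); rewrite size_polyXn; lia.
rewrite big_split_ord /= big1 ?add0r => [|s _]; last by rewrite coefMXn ltn_ord mul0r.
apply: eq_bigr => s _; rewrite coefMXn ltnNge leq_addr /= addKn.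
by congr (_ * nu _ _); lia.
Qed.

Lemma resQ_Xn u t i : resQ u t 'X^i = nu u (t + i).
Proof. by rewrite -['X^i]mul1r resQ_MXn /resQ size_poly1 big_ord1 coef1 mul1r add0n. Qed.

Lemma resQ_Qpol u t p : uc u n != 0 -> resQ u t (Qpol u * p) = 0.
Proof.
move=> un0; rewrite -[p]coefK poly_def mulr_sumr linear_sum big1 // => i _.
rewrite -scalerAr linearZ /= resQ_MXn (resQ_wide _ _ (size_Qpol u)).
under eq_bigr => s _ do rewrite coef_Qpol.
by rewrite qz_nu ?mulr0.
Qed.

Lemma drop_Qpol_sum u m : drop_poly m.+1 (Qpol u) = \sum_(d < n) qz u (m + d).+1 *: 'X^d.
Proof.
rewrite -[LHS](@coefK _ _) poly_def.
rewrite (big_ord_widen n (fun d => (drop_poly m.+1 (Qpol u))`_d *: 'X^d)); last first.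
  by rewrite size_drop_poly; have := size_Qpol u; lia.
rewrite big_mkcond; apply: eq_bigr => d _.
rewrite coef_drop_poly coef_Qpol addnS addnC; case: ltnP => // le.
rewrite -coef_Qpol [_`__](_ : _ = 0) ?scale0r //.
by rewrite addnC -addnS -coef_drop_poly nth_default.
Qed.

(* The [drop_poly m.+1 Q] form the basis dual to the z^c for the residue pairing. *)
Lemma resQ_dual u p m : (size p <= n)%N -> (m < n)%N ->
  resQ u 2 (p * drop_poly m.+1 (Qpol u)) = p`_m.
Proof.
move=> pn mn; rewrite drop_Qpol_sum mulr_sumr linear_sum /=.
transitivity (\sum_(d < n) \sum_(c < n) p`_c * (qz u (m + d).+1 * hc u (d + c))).
  apply: eq_bigr => d _; rewrite -scalerAr linearZ /= resQ_MXn (resQ_wide _ _ pn).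
  rewrite mulr_sumr; apply: eq_bigr => c _.
  by rewrite (_ : c + (2 + d) = (d + c).+2)%N /=; [ring|lia].
rewrite exchange_big /= (bigD1 (Ordinal mn)) //= -mulr_sumr qz_hc // eqxx mulr1.
rewrite big1 ?addr0 // => c /eqP cm; rewrite -mulr_sumr qz_hc //.
by case: eqP => [e|]; rewrite ?mulr0 //; case: cm; apply: val_inj.
Qed.

(* Modulo Q, one has P' * drop_poly j.+1 Q = Ghat_j and z P' = P. *)
Lemma coef_Ghat u m j : uc u n != 0 -> (m < n)%N -> (j < n)%N ->
  (Ghat u j)`_m =
  resQ u 1 (Ppol u * drop_poly m.+1 (Qpol u) * drop_poly j.+1 (Qpol u)).
Proof.
move=> un0 mn jn; rewrite -(resQ_dual u (size_Ghat u jn) mn).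
set A := drop_poly m.+1 _; set B := drop_poly j.+1 _.
have -> : Ghat u j * A = (Ppol u)^`() * B * A - Qpol u * (drop_poly j.+1 (Ppol u)^`() * A).
  by rewrite dPpol_Bezout -/A; ring.
rewrite raddfB /= resQ_Qpol // subr0 -[2%N]/(1 + 1)%N -resQ_MXn expr1.
have -> : (Ppol u)^`() * B * A * 'X = Ppol u * A * B + Qpol u * (A * B).
  by rewrite {1}/Qpol; ring.
by rewrite raddfD /= resQ_Qpol // addr0.
Qed.

(** The coefficient of z^(k-1) in lambda modulo Q: subtracting Q/(n-1) from P cancels z^n. *)
Definition Ecoef u k : F := (n - k)%:R / n.-1%:R * uc u (n - k).

(** In the residue formula [coef_Ghat], P may be replaced by its reduction [Eh], since [resQ] kills
    multiples of Q; expanding in monomials gives the sum. *)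
Lemma intersection_sum u m j : uc u n != 0 -> (m < n)%N -> (j < n)%N ->
  \sum_(k < n) \sum_(l < n) Ecoef u k * cs u (k + l) m * qz u (l + j).+1 =
  (Ghat u j)`_m.
Proof.
move=> un0 mn jn; rewrite coef_Ghat //.
pose Eh := \sum_(k < n) Ecoef u k *: 'X^k.
have EhE : Eh = Ppol u - n.-1%:R^-1 *: Qpol u.
  apply/polyP => i; rewrite coefB coefZ coef_Qpol coef_Ppol coef_sum.
  under eq_bigr => k _ do rewrite coefZ coefXn.
  have n1 := n1_neq0 F hn.
  have [lt|ge] := ltnP i n.
    rewrite (bigD1 (Ordinal lt)) //= eqxx mulr1 big1 ?addr0 => [|k /eqP ki]; last first.
      by case: eqP => [e|]; rewrite ?mulr0 //; case: ki; apply: val_inj.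
    rewrite (ltnW lt) qzE ?(ltnW lt) // /Ecoef natrB ?(ltnW lt) //.
    have -> : n%:R = n.-1%:R + 1 :> F by rewrite natr1 prednK //; lia.
    by field.
  rewrite big1 => [|k _]; last by case: eqP => [e|]; rewrite ?mulr0 //; have := ltn_ord k; lia.
  case: leqP => [le|gt]; last by rewrite qz_gt // mulr0 subr0.
  by rewrite (_ : i = n) ?qzn ?subnn ?mulVf ?subrr //; lia.
transitivity (resQ u 1 (Eh * drop_poly m.+1 (Qpol u) * drop_poly j.+1 (Qpol u))); last first.
  rewrite EhE !mulrBl -!scalerAl raddfB /= linearZ /= -(mulrA (Qpol u)) resQ_Qpol //.
  by rewrite mulr0 subr0.
rewrite /Eh mulr_suml mulr_suml linear_sum; apply: eq_bigr => k _ /=.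
rewrite [drop_poly j.+1 _]drop_Qpol_sum mulr_sumr linear_sum; apply: eq_bigr => l _ /=.
rewrite /cs mulr_sumr mulr_suml drop_Qpol_sum [_ *: _ * (\sum_(_ < _) _)]mulr_sumr.
rewrite [(\sum_(_ < _) _) * (_ *: _)]mulr_suml linear_sum.
apply: eq_bigr => d _ /=.
have -> : Ecoef u k *: 'X^k * (qz u (m + d).+1 *: 'X^d) * (qz u (j + l).+1 *: 'X^l) =
    (Ecoef u k * qz u (m + d).+1 * qz u (j + l).+1) *: 'X^(k + d + l).
  by rewrite -!mul_polyC !polyCM !exprD; ring.
rewrite linearZ /= resQ_Xn add1n /= (addnC l j) (addnAC k l d).
by ring.
Qed.

End SuperpotentialPolynomials.

(** * The cometric in terms of the roots of P *)

Section SplitPolynomials.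
Variables (F : numFieldType) (n : nat).
Implicit Types (x : 'I_n -> F) (u : 'rV[F]_n).

Definition root_prod x : {poly F} := \prod_(a < n) ('X + (x a)%:P).
Definition root_prod_but x k : {poly F} := \prod_(a < n | a != k) ('X + (x a)%:P).

Lemma root_prodD1 x k : root_prod x = ('X + (x k)%:P) * root_prod_but x k.
Proof. by rewrite /root_prod (bigD1 k). Qed.

Lemma deriv_root_prod x : (root_prod x)^`() = \sum_(k < n) root_prod_but x k.
Proof.
rewrite /root_prod /root_prod_but.
have H (s : seq 'I_n) : uniq s -> (\prod_(a <- s) ('X + (x a)%:P))^`() =
    \sum_(k <- s) \prod_(a <- s | a != k) ('X + (x a)%:P).
  elim: s => [|k s IH] /=; first by rewrite !big_nil derivC.
  move=> /andP[ks us]; rewrite !big_cons eqxx /= derivM derivD derivX derivC addr0 mul1r.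
  rewrite IH //; congr (_ + _).
    rewrite big_seq [RHS]big_seq_cond; apply: eq_bigl => a.
    by case: eqP => [->|]; rewrite ?andbT ?andbF // (negbTE ks).
  rewrite mulr_sumr [LHS]big_seq [RHS]big_seq; apply: eq_bigr => l ls.
  rewrite big_cons; case: eqP => [e|//]; by rewrite e ls in ks.
exact: (H (index_enum 'I_n) (index_enum_uniq _)).
Qed.

Lemma coef_root_prod x m : (m <= n)%N -> (root_prod x)`_m =
  \sum_(S : {set 'I_n} | #|S| == (n - m)%N) \prod_(a in S) x a.
Proof.
move=> mn; rewrite /root_prod; under eq_bigr => a _ do rewrite addrC.
rewrite bigA_distr coef_sum [RHS]big_mkcond; apply: eq_bigr => S _.
rewrite (bigID (mem S)) /=.
under eq_bigr => a aS do rewrite aS.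
under [X in _ * X]eq_bigr => a aS do rewrite (negbTE aS).
rewrite -(big_morph (@polyC F) (@polyCM F) (erefl _)) prodr_const coefCM coefXn.
have -> : #|[pred a | a \notin S]| = (n - #|S|)%N.
  by rewrite -[X in (X - _)%N]card_ord -(cardC (mem S)) addKn.
have Sn : (#|S| <= n)%N by rewrite -[X in (_ <= X)%N]card_ord max_card.
have -> : (m == n - #|S|)%N = (#|S| == n - m)%N by lia.
by case: eqP; rewrite ?mulr1 ?mulr0.
Qed.

Lemma size_root_prod x : size (root_prod x) = n.+1.
Proof.
rewrite /root_prod; under eq_bigr => a _ do rewrite -[x a]opprK polyCN.
by rewrite size_prod_XsubC /index_enum -enumT size_enum_ord.
Qed.

Lemma Ppol_root_prod u x : (forall i : 'I_n, u 0 i =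
    \sum_(S : {set 'I_n} | #|S| == i.+1) \prod_(a in S) x a) ->
  Ppol u = root_prod x.
Proof.
move=> ux; apply/polyP => m; rewrite coef_Ppol; case: leqP => mn; last first.
  by rewrite nth_default // size_root_prod.
rewrite coef_root_prod //; case E : (n - m)%N => [|k].
  by rewrite (big_pred1 (finset.set0 : {set _})) ?finset.big_set0 // => S; exact: cards_eq0.
have kn : (k < n)%N by lia.
by rewrite -[k]/(nat_of_ord (Ordinal kn)) uc_ord ux.
Qed.

(** The full double sum gives P'(z) P'(w), and the diagonal gives the Bezoutian: as P = (z + x_k)
    B_k, the quotients of P and B_k combine to the coefficient of w^j in B_k(z) B_k(w). *)
Lemma pair_sum_root_prod u x j m : Ppol u = root_prod x ->
  \sum_(k < n) \sum_(l < n) (1 - ((k == l) : nat)%:R) *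
     (root_prod_but x k)`_m * (root_prod_but x l)`_j = (Ghat u j)`_m.
Proof.
move=> PE; pose B := root_prod_but x.
suff -> : Ghat u j = \sum_(k < n) \sum_(l < n)
    ((1 - ((k == l) : nat)%:R) * (B l)`_j) *: B k.
  rewrite coef_sum; apply: eq_bigr => k _; rewrite coef_sum; apply: eq_bigr => l _.
  by rewrite coefZ mulrAC.
have -> : \sum_(k < n) \sum_(l < n) ((1 - ((k == l) : nat)%:R) * (B l)`_j) *: B k =
    (\sum_(l < n) (B l)`_j) *: (\sum_(k < n) B k) - \sum_(k < n) (B k)`_j *: B k.
  rewrite scaler_sumr -sumrB; apply: eq_bigr => k _.
  rewrite scaler_suml (bigD1 k) //= [in RHS](bigD1 k) //= eqxx subrr mul0r scale0r.
  rewrite add0r addrAC subrr add0r; apply: eq_bigr => l /negbTE lk.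
  by rewrite eq_sym lk subr0 mul1r.
rewrite -deriv_root_prod -coef_sum -deriv_root_prod -PE /Ghat; congr (_ - _).
rewrite PE deriv_root_prod drop_poly_sum !mulr_suml mulr_sumr -sumrB.
apply: eq_bigr => k _; rewrite (root_prodD1 x k) -/(B k) mulrDl.
rewrite drop_polyD drop_polyXM mul_polyC drop_polyZ (drop_polyS j) -!mul_polyC.
by ring.
Qed.

End SplitPolynomials.

(** * Derivations at a point and partial derivatives *)

Section PartialDerivatives.
Variables (R : realType) (n : nat).
Local Notation C := (Cx R).
Local Notation pt := 'rV[C]_n.
Implicit Types (f g : pt -> C) (u x v : pt).

(** Covers both the partial derivatives and the derivative along the Euler field, so that h is
    differentiated by one argument. *)
Definition point_derivation (x : pt) (D : (pt -> C) -> C) : Prop :=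
  [/\ forall f g, differentiable f x -> differentiable g x ->
        D (fun v => f v + g v) = D f + D g,
      forall f g, differentiable f x -> differentiable g x ->
        D (fun v => f v * g v) = f x * D g + g x * D f
    & forall a, D (fun _ => a) = 0].

Lemma pd_derivation m x : point_derivation x (fun f => pd f m x).
Proof.
split=> [f g df dg|f g df dg|a]; rewrite /pd.
- by rewrite (@deriveD _ _ _ f g) //; exact: diff_derivable.
- by rewrite (@deriveM _ _ f g) //; exact: diff_derivable.
- exact: derive_cst.
Qed.

Lemma sum_derivation (I : finType) (w : I -> C) (D : I -> (pt -> C) -> C) x :
  (forall i, point_derivation x (D i)) ->
  point_derivation x (fun f => \sum_i w i * D i f).
Proof.
move=> HD; split=> [f g df dg|f g df dg|a].
- by rewrite -big_split; apply: eq_bigr => i _; have [-> //] := HD i; rewrite mulrDr.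
- rewrite !mulr_sumr -big_split; apply: eq_bigr => i _; have [_ -> // _] := HD i.
  by rewrite /=; ring.
- by rewrite big1 // => i _; have [_ _ ->] := HD i; rewrite mulr0.
Qed.

Lemma differentiable_bigsum (I : Type) (s : seq I) (f : I -> pt -> C) x :
  (forall i, differentiable (f i) x) ->
  differentiable (fun v => \sum_(i <- s) f i v) x.
Proof.
move=> df; elim: s => [|i s IH].
  by under eq_fun do rewrite big_nil; exact: differentiable_cst.
by under eq_fun do rewrite big_cons; apply: (@differentiableD _ _ _ (f i)).
Qed.

Section Derivation.
Variables (x : pt) (D : (pt -> C) -> C).
Hypothesis DD : point_derivation x D.

Lemma derivation_sum (I : Type) (s : seq I) (f : I -> pt -> C) :
  (forall i, differentiable (f i) x) ->
  D (fun v => \sum_(i <- s) f i v) = \sum_(i <- s) D (f i).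
Proof.
have [Dadd _ Dc] := DD; move=> df; elim: s => [|i s IH].
  by under [in LHS]eq_fun do rewrite big_nil; rewrite big_nil Dc.
under [in LHS]eq_fun do rewrite big_cons.
by rewrite Dadd ?big_cons ?IH //; exact: differentiable_bigsum.
Qed.

Lemma derivationZ a f : differentiable f x -> D (fun v => a * f v) = a * D f.
Proof.
have [_ Dm Dc] := DD; move=> df.
by rewrite (Dm (fun=> a) f) // ?Dc ?mulr0 ?addr0 //; exact: differentiable_cst.
Qed.

End Derivation.

(** The closed formulas for the metrics hold only where u_n is nonzero; openness lets them be
    differentiated there. *)
Lemma pd_local (U : set pt) f g m x : open U -> U x ->
  (forall v, U v -> f v = g v) -> pd f m x = pd g m x.
Proof.
move=> oU Ux fg; rewrite /pd; apply: near_eq_derive.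
near=> v; apply: fg; near: v; exact: open_nbhs_nbhs.
Unshelve. all: by end_near. Qed.

Lemma differentiable_local (U : set pt) f g x : open U -> U x ->
  (forall v, U v -> f v = g v) -> differentiable g x -> differentiable f x.
Proof.
move=> oU Ux fg dg.
have cg : continuous ('d g x) by exact: diff_continuous.
have E : f \o shift x = cst (f x) + 'd g x +o_ (0 : pt) id.
  apply/eqaddoP => e e0.
  have /eqaddoP/(_ e e0) := diff_locally dg.
  apply: filter_app.
  have : \forall y \near x, U y by exact: open_nbhs_nbhs.
  rewrite (near_shift (0 : pt)) subr0 => near_U.
  apply: filterS near_U => h /= Uh.
  by rewrite /= !fctE /= fg // (fg x).
have dfg := diff_unique cg E.
apply/diff_locallyP; exact: (eq_ind_r (fun d : pt -> C =>
  continuous d /\ f \o shift x = cst (f x) + d +o_ (0 : pt) id) (conj cg E) dfg).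
Qed.

(** Suffices for the explicit derivatives: the invariants are quadratic in each p_k, and the u_k and
    Ghat are affine along the lines used. *)
Lemma pd_quadratic f m x (b c : C) :
  (forall t : C, f (t *: ecoord R n m + x) = f x + t * b + t ^+ 2 * c) -> pd f m x = b.
Proof.
move=> ft.
have E : pd f m x = 'D_1 (fun t : C => f x + t * b + t ^+ 2 * c) 0.
  rewrite /pd /derive; set F1 := (fun h => _ *: _); set F2 := (X in _ = lim (X @ _)%classic).
  suff -> : F1 = F2 by [].
  apply/funext => h; rewrite /F1 /F2 /= ft addr0 scaler1 mul0r expr0n /= mul0r !addr0.
  by [].
rewrite E.
pose G (t : C) : C := b + t * c.
have dG : derivable G 0 1.
  apply: (@derivableD _ _ _ (cst b) (fun t : C => t * c)); first exact: derivable_cst.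
  by apply: (@derivableM _ _ id (cst c)); [exact: derivable_id|exact: derivable_cst].
have dP : derivable (id * G : C -> C) 0 1.
  apply: derivableM; last exact: dG.
  exact: derivable_id.
have -> : (fun t : C => f x + t * b + t ^+ 2 * c) = (cst (f x) : C -> C) + id * G.
  by apply/funext => t; rewrite !fctE /G; ring.
have dc : derivable (cst (f x) : C -> C) 0 1 by exact: derivable_cst.
have di : derivable (id : C -> C) 0 1 by exact: derivable_id.
rewrite (deriveD dc dP) derive_cst (deriveM di dG).
rewrite derive_id scale0r !add0r /G mul0r addr0.
exact: mulr1.
Qed.

End PartialDerivatives.

(** * Derivatives and weights of the coefficients of 1/Q *)

Section ResolventDerivatives.
Variables (R : realType) (n : nat).
Local Notation C := (Cx R).
Local Notation pt := 'rV[C]_n.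
Implicit Types (f g : pt -> C) (u x v : pt) (k m i j c s : nat).

Lemma uc_shift k m (t : C) x : (m < n)%N ->
  uc (t *: ecoord R n m + x) k = uc x k + t * (k == m.+1)%:R.
Proof.
move=> mn; case: k => [|k] /=; first by rewrite mulr0 addr0.
rewrite /uc; case: insubP => [i _ ki|nk] /=; last first.
  by rewrite eqSS (_ : (k == m) = false) ?mulr0 ?addr0 //; lia.
by rewrite !mxE ki eqSS addrC.
Qed.

Hypothesis hn : (2 <= n)%N.

Lemma differentiable_mul f g x : differentiable f x -> differentiable g x ->
  differentiable (fun v => f v * g v) x.
Proof. exact: differentiableM. Qed.

Lemma differentiable_uc k x : differentiable (fun v : pt => uc v k) x.
Proof.
case: k => [|k]; first exact: differentiable_cst.
rewrite /uc; case: insub => [i|] /=; first exact: differentiable_coord.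
exact: differentiable_cst.
Qed.

Lemma differentiable_qh k x : differentiable (fun v : pt => qh v k) x.
Proof.
by apply: (differentiable_mul (f := fun=> _)); [exact: differentiable_cst|exact: differentiable_uc].
Qed.

Lemma differentiable_qz k x : differentiable (fun v : pt => qz v k) x.
Proof.
by rewrite /qz; case: (k <= n)%N; [exact: differentiable_qh|exact: differentiable_cst].
Qed.

Lemma differentiable_hc k x : differentiable (fun v : pt => hc v k) x.
Proof.
elim/ltn_ind: k => k IH; under eq_fun do rewrite hc_rec.
apply: (differentiable_mul (f := fun=> _)); first exact: differentiable_cst.
apply: (@differentiableB _ _ _ (fun=> _)); first exact: differentiable_cst.
apply: differentiable_bigsum => i; apply: differentiable_mul; first exact: differentiable_qh.
exact: IH.
Qed.

Lemma differentiable_mu s x : uc x n != 0 -> differentiable (fun v : pt => mu v s) x.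
Proof.
case: s => [|s] un0 /=; last exact: differentiable_hc.
by apply: differentiableV => //; exact: differentiable_uc.
Qed.

Lemma differentiable_cs s c x : uc x n != 0 -> differentiable (fun v : pt => cs v s c) x.
Proof.
move=> un0; apply: differentiable_bigsum => d.
by apply: differentiable_mul; [exact: differentiable_qz|exact: differentiable_mu].
Qed.

Lemma pd_uc k m x : (m < n)%N -> pd (fun v : pt => uc v k) m x = (k == m.+1)%:R.
Proof.
by move=> mn; apply: (pd_quadratic (c := 0)) => t; rewrite mulr0 addr0 uc_shift.
Qed.

Section Derivation.
Variables (x : pt) (D : (pt -> C) -> C).
Hypothesis DD : point_derivation x D.

Lemma derivation_conv_hc k :
  conv (qh x) (fun i => D (fun v => hc v i)) k +
  conv (fun i => D (fun v => qh v i)) (hc x) k = 0.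
Proof.
have [_ Dm Dc] := DD.
have : D (fun v => conv (qh v) (hc v) k) = 0.
  by under [in LHS]eq_fun do rewrite qh_hc //; rewrite Dc.
rewrite /conv (derivation_sum DD) => [E|i]; last first.
  by apply: differentiable_mul; [exact: differentiable_qh|exact: differentiable_hc].
rewrite -big_split -[RHS]E; apply: eq_bigr => i _.
rewrite (Dm (fun v => qh v i) (fun v => hc v (k - i)));
  [|exact: differentiable_qh|exact: differentiable_hc].
by rewrite [hc x _ * _]mulrC.
Qed.

(* Up to a shift, hc is the reciprocal of qh. *)
Lemma derivation_hc_unique (X : nat -> C) :
  (forall k, conv (qh x) X k + conv (fun i => D (fun v => qh v i)) (hc x) k = 0) ->
  forall k, D (fun v => hc v k) = X k.
Proof.
move=> HX k; pose Y i := D (fun v => hc v i) - X i.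
have Y0 j : conv (qh x) Y j = 0.
  rewrite /conv; under eq_bigr => i _ do rewrite mulrBr.
  rewrite sumrB; apply/eqP; rewrite subr_eq0; apply/eqP.
  apply: (addIr (conv (fun i => D (fun v => qh v i)) (hc x) j)).
  by have := derivation_conv_hc j; have := HX j; rewrite /conv => -> ->.
apply/eqP; rewrite -subr_eq0 -/(Y k); apply/eqP.
(* Multiplying by 1/Q cancels Q; the delta at n-1 in [qh_hc] accounts for the shifted index. *)
have : conv (hc x) (conv (qh x) Y) (k + n.-1) = 0.
  by rewrite /conv big1 // => i _; rewrite -/(conv _ _ _) Y0 mulr0.
rewrite convA (eq_conv (f' := fun i => (i == n.-1)%:R) (g' := Y)) //.
  by rewrite conv_delta leq_addl addnK.
by move=> i _; rewrite convC qh_hc.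
Qed.

End Derivation.

Lemma qh_HH_shift x c k : (c < n)%N ->
  conv (qh x) (fun i => HH x (i + c).-1) k = if (n <= k + c)%N then hc x (k + c - n) else 0.
Proof.
move=> cn; transitivity (conv (qh x) (HH x) (k + c).-1); last first.
  rewrite qh_HH // (_ : (n.-1 <= (k + c).-1) = (n <= k + c))%N; last by lia.
  by case: ifP => // _; congr (hc x _); lia.
apply: (@sum_shift _ k.+1 (k + c).-1.+1 0 0
   (fun i => qh x i * HH x (k - i + c).-1)
   (fun i => qh x i * HH x ((k + c).-1 - i))).
- by move=> m p mk pk; rewrite !addn0 => <-; congr (_ * HH x _); lia.
- move=> m mk H; rewrite HH_small ?mulr0 //.
  have mN : ~~ (m < (k + c).-1.+1)%N.
    by apply/negP => /H; rewrite eqxx.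
  lia.
- move=> p pN H; rewrite HH_small ?mulr0 //.
  have mN : ~~ (p < k.+1)%N by apply/negP => /H; rewrite eqxx.
  lia.
Qed.

Lemma pd_qh k m x : (m < n)%N ->
  pd (fun v : pt => qh v k) m x = (n.-1%:R - k%:R) * (k == m.+1)%:R.
Proof.
move=> mn; rewrite /qh (derivationZ (pd_derivation m x)) ?pd_uc //.
exact: differentiable_uc.
Qed.

(** Since dQ/du_(n-c) = (c-1) z^c, the derivative of 1/Q is (1-c) z^c / Q^2. The 0-based coordinate
    of u_(n-c) is n-c-1. *)
Lemma pd_hc k c x : (c < n)%N ->
  pd (fun v : pt => hc v k) (n - c.+1) x = (1 - c%:R) * HH x (k + c).-1.
Proof.
move=> cn; pose X i : C := (1 - c%:R) * HH x (i + c).-1.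
apply: (derivation_hc_unique (pd_derivation (n - c.+1) x) (X := X)) => {}k.
have -> : conv (qh x) X k = (1 - c%:R) * conv (qh x) (fun i => HH x (i + c).-1) k.
  by rewrite /conv mulr_sumr; apply: eq_bigr => i _; rewrite /X mulrCA.
rewrite qh_HH_shift //.
have -> : conv (fun i => pd (fun v : pt => qh v i) (n - c.+1) x) (hc x) k =
   (c%:R - 1) * conv (fun i => (i == (n - c)%N)%:R) (hc x) k.
  rewrite /conv mulr_sumr; apply: eq_bigr => i _.
  rewrite pd_qh ?mulrA; last by lia.
  rewrite (_ : (i == (n - c.+1).+1 :> nat)%N = (i == n - c :> nat)%N); last by lia.
  case: eqP => [->|]; rewrite ?mulr0 ?mul0r // natrB; last by lia.
  have -> : n%:R = n.-1%:R + 1 :> C by rewrite natr1 prednK //; lia.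
  by rewrite /=; ring.
rewrite conv_delta leq_subLR (addnC c); case: ifP => [nk|_]; last by rewrite !mulr0 addr0.
by rewrite (_ : k - (n - c) = k + c - n)%N; [ring|lia].
Qed.

Lemma pd_un c x : (c < n)%N -> pd (fun v : pt => uc v n) (n - c.+1) x = (c == 0%N)%:R.
Proof. by move=> cn; rewrite pd_uc; [congr (_%:R); congr nat_of_bool|]; lia. Qed.

Lemma pd_mu0 m x : uc x n != 0 ->
  pd (fun v : pt => mu v 0) m x = - (uc x n) ^- 2 * pd (fun v : pt => uc v n) m x.
Proof.
move=> un0; rewrite /pd deriveV //; apply: diff_derivable; exact: differentiable_uc.
Qed.

Definition Efield u (i : 'I_n) : C := i.+1%:R / n.-1%:R * u 0 i.
Definition Euler x f : C := \sum_(l < n) Efield x l * pd f l x.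

Lemma Euler_derivation x : point_derivation x (Euler x).
Proof. by apply: sum_derivation => i; exact: pd_derivation. Qed.

Lemma Euler_uc k x : Euler x (fun v => uc v k) = k%:R / n.-1%:R * uc x k.
Proof.
rewrite /Euler; under eq_bigr => l _ do rewrite pd_uc //.
case: k => [|k]; first by rewrite big1 ?mul0r // => l _; rewrite mulr0.
have [kn|nk] := ltnP k n; last first.
  rewrite uc_gt // mulr0 big1 // => l _; rewrite eqSS.
  by rewrite (_ : (k == l) = false) ?mulr0 //; have := ltn_ord l; lia.
rewrite (bigD1 (Ordinal kn)) //= eqxx mulr1 big1 ?addr0; last first.
  by move=> l /eqP lk; case: eqP => [[e]|]; rewrite ?mulr0 //; case: lk; apply: val_inj.
by rewrite /Efield -uc_ord.
Qed.

Lemma Euler_qh k x : Euler x (fun v => qh v k) = k%:R / n.-1%:R * qh x k.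
Proof.
rewrite /qh (derivationZ (Euler_derivation x)) ?Euler_uc; first by rewrite mulrCA.
exact: differentiable_uc.
Qed.

Lemma Euler_qz k x : Euler x (fun v => qz v k) = (n%:R - k%:R) / n.-1%:R * qz x k.
Proof.
rewrite /qz; case: leqP => kn; first by rewrite Euler_qh natrB.
by have [_ _ ->] := Euler_derivation x; rewrite mulr0.
Qed.

(** With u_k of weight k/(n-1) and z of weight 1/(n-1), Q is homogeneous of weight n/(n-1), which
    fixes the weight of each coefficient of 1/Q. *)
Lemma Euler_hc k x : Euler x (fun v => hc v k) = (k.+1%:R - n%:R) / n.-1%:R * hc x k.
Proof.
pose X i : C := (i.+1%:R - n%:R) / n.-1%:R * hc x i.
apply: (derivation_hc_unique (Euler_derivation x) (X := X)) => {}k.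
transitivity ((k.+1%:R - n%:R) / n.-1%:R * conv (qh x) (hc x) k).
  rewrite /conv -big_split mulr_sumr; apply: eq_bigr => i _ /=.
  have ik : (i <= k)%N by have := ltn_ord i.
  rewrite Euler_qh /X -subSn // natrB; last by lia.
  by ring.
rewrite qh_hc //; case: eqP => [->|]; rewrite ?mulr0 // prednK ?subrr ?mul0r //; lia.
Qed.

Lemma Euler_mu s x : uc x n != 0 ->
  Euler x (fun v => mu v s) = (s%:R - n%:R) / n.-1%:R * mu x s.
Proof.
case: s => [|s] un0; last exact: Euler_hc.
transitivity (- (uc x n) ^- 2 * Euler x (fun v => uc v n)).
  by rewrite /Euler mulr_sumr; apply: eq_bigr => l _; rewrite pd_mu0 //; ring.
by rewrite Euler_uc /=; field; rewrite un0 n1_neq0.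
Qed.

Lemma Euler_cs s c x : uc x n != 0 -> (c < n)%N ->
  Euler x (fun v => cs v s c) = (s%:R - c%:R - 1) / n.-1%:R * cs x s c.
Proof.
move=> un0 cn; rewrite /cs (derivation_sum (Euler_derivation x)) => [|d]; last first.
  by apply: differentiable_mul; [exact: differentiable_qz|exact: differentiable_mu].
rewrite mulr_sumr; apply: eq_bigr => d _.
have [_ Dm _] := Euler_derivation x.
rewrite (Dm (fun v => qz v (c + d).+1) (fun v => mu v (s + d)));
  [|exact: differentiable_qz|exact: differentiable_mu].
rewrite Euler_qz Euler_mu // -natr1 !natrD.
by field; rewrite n1_neq0.
Qed.

End ResolventDerivatives.

(** * The metrics and the Frobenius structure on the orbit space *)

Section OrbitSpace.
Variables (R : realType) (n : nat).
Local Notation C := (Cx R).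
Local Notation pt := 'rV[C]_n.
Implicit Types (p u v : pt) (i j k l : 'I_n).
(* the direction d/du_(i+1) = z^(rv i - 1): all formulas are stated in [rv i] *)
Local Notation rv i := (n - (nat_of_ord i).+1)%N.

Lemma rv_lt i : (rv i < n)%N.
Proof. by have := ltn_ord i; lia. Qed.

Lemma rvK i : (n - (rv i).+1)%N = i.
Proof. by have := ltn_ord i; lia. Qed.

Lemma rv_eq i j : (rv i == rv j) = (i == j).
Proof.
by apply/eqP/eqP => [e|->] //; apply: val_inj => /=; have := ltn_ord i; have := ltn_ord j; lia.
Qed.

Lemma sum_rv (K : nat -> C) : \sum_(m < n) K (rv m) = \sum_(m < n) K m.
Proof. by rewrite [RHS](reindex_inj rev_ord_inj). Qed.

Hypothesis hn : (2 <= n)%N.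

Lemma UdomP u : @Udom R n u <-> uc u n != 0.
Proof.
have n1n : (n.-1 < n)%N by lia.
have E k : (k : nat) = n.-1 -> uc u n = u 0 k.
  by move=> kn; rewrite -uc_ord kn prednK //; lia.
split=> [H|H k kn]; last by rewrite -(E k).
by rewrite (E (Ordinal n1n)) //; exact: H.
Qed.

Lemma open_Udom : open (@Udom R n).
Proof.
have -> : @Udom R n = ((fun u : pt => uc u n) @^-1` (~` [set 0 : C]))%classic.
  by apply/seteqP; split=> u /= => [/UdomP/eqP //|/eqP]; move/UdomP.
apply: open_comp => [u _|]; first exact: (differentiable_continuous (differentiable_uc n u)).
apply/closed_openC/accessible_closed_set1/hausdorff_accessible.
exact: norm_hausdorff.
Qed.

Let sq p (a : 'I_n) : C := p 0 a ^+ 2.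

Lemma inv_u_coef p i : inv_u p 0 i = (root_prod (sq p))`_(rv i).
Proof.
rewrite coef_root_prod; last by lia.
rewrite mxE; apply: eq_bigl => S; congr (_ == _).
by have := ltn_ord i; lia.
Qed.

Lemma Ppol_inv_u p : Ppol (inv_u p) = root_prod (sq p).
Proof. by apply: Ppol_root_prod => i; rewrite mxE. Qed.

Lemma pd_inv_u p i k :
  pd (fun q => inv_u q 0 i) k p = 2 * p 0 k * (root_prod_but (sq p) k)`_(rv i).
Proof.
set B := root_prod_but _ k.
apply: (pd_quadratic (c := B`_(rv i))) => t.
rewrite !inv_u_coef !(root_prodD1 _ k) -/B.
have -> : root_prod_but (sq (t *: ecoord R n k + p)) k = B.
  apply: eq_bigr => a /negbTE ak; congr ('X + _%:P).
  by rewrite /sq !mxE (_ : (a == k :> nat) = false) // mulr0 add0r.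
rewrite /sq !mxE eqxx mulr1 !mulrDl !coefD !coefCM; ring.
Qed.

(** The factors 2 p_k and 2 p_l from the derivatives of the invariants cancel the denominator p_k
    p_l and leave 4. *)
Lemma g_pullbackE p i j : (forall k, p 0 k != 0) ->
  g_pullback p i j = 4 * (Ghat (inv_u p) (rv j))`_(rv i).
Proof.
move=> p0; rewrite -(pair_sum_root_prod (x := sq p)) ?Ppol_inv_u //.
rewrite mulr_sumr; apply: eq_bigr => k _; rewrite mulr_sumr; apply: eq_bigr => l _.
by rewrite !pd_inv_u; field; rewrite !p0.
Qed.

(** Take for p_a a square root of minus the a-th root of P. Hence the pullback condition determines
    g wherever u_n is nonzero. *)
Lemma inv_u_surj u : uc u n != 0 -> exists2 p : pt, (forall k, p 0 k != 0) & inv_u p = u.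
Proof.
move=> un0; have := closed_field_poly_normal (Ppol u : {poly R[i]}).
move=> [r Pr].
have sP : size (Ppol u) = n.+1.
  apply/eqP; rewrite eqn_leq size_Ppol ltnNge; apply/negP => le.
  have : (Ppol u)`_n = 0 by apply: nth_default.
  by rewrite coef_Ppol leqnn subnn; apply/eqP/oner_neq0.
have lP : lead_coef (Ppol u) = 1 by rewrite lead_coefE sP coef_Ppol leqnn subnn.
rewrite [lead_coef _]lP scale1r in Pr.
have sr : size r = n by have := sP; rewrite Pr size_prod_XsubC => -[].
pose p : pt := \row_a (sqrtC (- r`_a) : R[i]).
have E : root_prod (sq p) = Ppol u.
  rewrite Pr (big_nth 0) sr big_mkord; apply: eq_bigr => a _.
  by rewrite /sq mxE (sqrtCK (- r`_a : R[i])) polyCN.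
have pE : inv_u p = u.
  apply/rowP => i; rewrite inv_u_coef E coef_Ppol leq_subr.
  by rewrite -uc_ord subKn.
exists p => // k; apply: contraNneq un0 => pk0.
have -> : uc u n = (root_prod (sq p))`_0 by rewrite E coef_Ppol leq0n subn0.
by rewrite (root_prodD1 _ k) /sq pk0 expr0n /= addr0 coefXM.
Qed.

Lemma Ppol_shift c (t : C) u : (c < n)%N ->
  Ppol (t *: ecoord R n (n - c.+1) + u) = Ppol u + t *: 'X^c.
Proof.
move=> cn; apply/polyP => m; rewrite coefD coefZ coefXn !coef_Ppol.
case: leqP => mn; last by rewrite (_ : (m == c) = false) ?mulr0 ?addr0 //; lia.
rewrite uc_shift //; last by lia.
by congr (_ + _ * _%:R); congr nat_of_bool; lia.
Qed.

(** Moving u_(n-1) adds t z to P, which leaves Q unchanged; the t^2 terms cancel, so Ghat is affine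
    with slope the Bezout quotient of Q. *)
Lemma Ghat_shift (t : C) u (j : nat) :
  Ghat (t *: ecoord R n n.-2 + u) j = Ghat u j + t *: drop_poly j.+1 (Qpol u).
Proof.
have -> : n.-2 = (n - 2)%N by lia.
rewrite drop_Qpol drop_polyS /Ghat Ppol_shift // expr1 derivD derivZ derivX.
rewrite !drop_polyD !drop_polyZ !coefD !coefZ coef1.
have -> : drop_poly j.+1 (1 : {poly C}) = 0.
  by rewrite drop_poly_eq0 // size_poly1.
have -> : drop_poly j.+1 ('X : {poly C}) = ((j == 0)%:R)%:P.
  apply/polyP => i; rewrite coef_drop_poly coefX coefC addnS eqSS addn_eq0.
  by case: i.
by rewrite -!mul_polyC polyCD polyCM; ring.
Qed.

Variable g : pt -> 'M[C]_n.
Hypothesis hg : forall p : pt, (forall k, p 0 k != 0) ->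
  g (inv_u p) = ((4 * n.-1)%:R)^-1 *: \matrix_(i, j) g_pullback p i j.

Local Notation eta := (eta_of g).
Local Notation U := (@Udom R n).
Local Notation n1 := (n.-1%:R : C).

Lemma n1C : n1 != 0. Proof. exact: n1_neq0. Qed.

Lemma gE u i j : uc u n != 0 -> g u i j = n1^-1 * (Ghat u (rv j))`_(rv i).
Proof.
move=> /inv_u_surj[p p0 <-]; rewrite (hg p0) !mxE g_pullbackE // natrM.
have := n1C; set G := (Ghat _ _)`_ _; move: (n1) => z z0.
by field; rewrite z0.
Qed.

Lemma etaE u i j : uc u n != 0 -> eta u i j = n1^-1 * qz u (rv i + rv j).+1.
Proof.
move=> un0; rewrite mxE.
rewrite (pd_local (U := U) (g := fun v => n1^-1 * (Ghat v (rv j))`_(rv i))).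
- apply: (pd_quadratic (c := 0)) => t; rewrite mulr0 addr0 Ghat_shift coefD coefZ.
  by rewrite coef_drop_poly coef_Qpol // addnS; ring.
- exact: open_Udom.
- exact/UdomP.
- by move=> v /UdomP vn0; rewrite gE.
Qed.

Lemma eta_hc u : uc u n != 0 ->
  eta u *m (\matrix_(i, j) (n1 * hc u (rv i + rv j))) = 1%:M.
Proof.
move=> un0; apply/matrixP => i j; rewrite !mxE -rv_eq -(qz_hc hn u (rv_lt i) (rv_lt j)).
rewrite -(sum_rv (fun b => qz u (rv i + b).+1 * hc u (b + rv j))).
apply: eq_bigr => l _; rewrite etaE // !mxE.
by rewrite mulrACA mulVf ?n1C // mul1r.
Qed.

Lemma eta_unit u : uc u n != 0 -> eta u \in unitmx.
Proof. by move=> un0; have [] := mulmx1_unit (eta_hc un0). Qed.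

Lemma etalE u i j : uc u n != 0 -> etal eta u i j = n1 * hc u (rv i + rv j).
Proof.
move=> un0; rewrite /etal -[invmx _]mulmx1 -(eta_hc un0) mulKmx ?eta_unit //.
by rewrite mxE.
Qed.

Lemma pd_etal u i j l : uc u n != 0 ->
  pd (fun v => etal eta v i j) l u = n1 * ((1 - (rv l)%:R) * HH u (rv i + rv j + rv l).-1).
Proof.
move=> un0; rewrite (pd_local (U := U) (g := fun v => n1 * hc v (rv i + rv j))).
- rewrite (derivationZ (pd_derivation l u)); last exact: differentiable_hc.
  by rewrite -{1}(rvK l) pd_hc // rv_lt.
- exact: open_Udom.
- exact/UdomP.
- by move=> v /UdomP vn0; rewrite etalE.
Qed.

Lemma sum_qz_hc u a (K : nat -> C) : (a < n)%N ->
  \sum_(l < n) qz u (a + l).+1 * \sum_(c < n) hc u (c + l) * K c = K a.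
Proof.
move=> an; under eq_bigr => l _ do rewrite mulr_sumr.
rewrite exchange_big /=.
transitivity (\sum_(c < n) (a == c)%:R * K c).
  apply: eq_bigr => c _; rewrite -(qz_hc hn u an (ltn_ord c)) mulr_suml.
  by apply: eq_bigr => l _; rewrite mulrA (addnC c).
rewrite (bigD1 (Ordinal an)) //= eqxx mul1r big1 ?addr0 // => c /eqP ca.
by case: eqP => [e|]; rewrite ?mul0r //; case: ca; apply: val_inj.
Qed.

(** By [hc_window_sum], the symbol with lowered index is the h-Hankel matrix applied to the vector c
    h_(i+j-c-1); raising the index undoes that matrix and leaves the entry c = k. *)
Lemma ChrE u k i j : uc u n != 0 ->
  Chr eta k i j u = - (rv k)%:R * hc u (rv i + rv j - (rv k).+1).
Proof.
move=> un0; rewrite /Chr.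
transitivity (- \sum_(l < n) qz u (rv k + rv l).+1 *
   \sum_(c < n) hc u (c + rv l) * (c%:R * hc u (rv i + rv j - c.+1))).
  rewrite mulr_sumr -sumrN; apply: eq_bigr => l _.
  rewrite !pd_etal // etaE //.
  set S := \sum_(c < n) _.
  have HS : 2 * S = ((rv i + rv j)%:R - 1 - (rv l)%:R) * HH u (rv i + rv j + rv l).-1.
    by apply: hc_window_sum => //; [exact: rv_lt|have := rv_lt i; have := rv_lt j; lia].
  have -> : S = 2^-1 * (((rv i + rv j)%:R - 1 - (rv l)%:R) * HH u (rv i + rv j + rv l).-1).
    by rewrite -HS mulrA mulVf ?mul1r // pnatr_eq0.
  rewrite (_ : rv l + rv j + rv i = rv i + rv j + rv l)%N; last by lia.
  rewrite (_ : rv l + rv i + rv j = rv i + rv j + rv l)%N; last by lia.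
  move: (HH _ _) (qz _ _) n1C => h q; rewrite natrD; move: n1 => z z0.
  by field.
rewrite (sum_rv (fun b => qz u (rv k + b).+1 *
  \sum_(c < n) hc u (c + b) * (c%:R * hc u (rv i + rv j - c.+1)))).
by rewrite (sum_qz_hc u (fun c => c%:R * hc u (rv i + rv j - c.+1)) (rv_lt k)) mulNr.
Qed.


(** In reversed indices, the derivative part is l (j - k) [HH u N] and the quadratic part l (k - j)
    [HH u N]. *)
Lemma RiemE u l i j k : uc u n != 0 -> Riem eta l i j k u = 0.
Proof.
move=> un0; pose N := (rv i + rv j + rv k - (rv l).+2)%N.
have pdC (a b : 'I_n) : (rv a + rv b + rv i = rv i + rv j + rv k)%N ->
    pd (Chr eta l a i) b u = - (rv l)%:R * ((1 - (rv b)%:R) * HH u N).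
  move=> abi.
  rewrite (pd_local (U := U) (g := fun v => - (rv l)%:R * hc v (rv a + rv i - (rv l).+1))).
  - rewrite (derivationZ (pd_derivation b u)); last exact: differentiable_hc.
    rewrite -{1}(rvK b) pd_hc ?rv_lt //; congr (_ * (_ * _)).
    (* If the difference truncates, both indices are too small for [HH] to be nonzero. *)
    have [le|gt] := leqP (rv l).+1 (rv a + rv i); first by congr (HH u _); lia.
    by rewrite !HH_small //; have := rv_lt b; lia.
  - exact: open_Udom.
  - exact/UdomP.
  - by move=> v /UdomP vn0; rewrite ChrE.
have e1 : (rv k + rv j + rv i = rv i + rv j + rv k)%N by rewrite addnC (addnC (rv k)) addnA.
have e2 : (rv j + rv k + rv i = rv i + rv j + rv k)%N by rewrite addnC addnA.
pose T (a b : nat) : C := \sum_(m < n) (rv l)%:R * hc u (a + m - (rv l).+1) *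
  (m%:R * hc u (b + rv i - m.+1)).
have TE (a b : 'I_n) : (rv i + rv a + rv b = rv i + rv j + rv k)%N ->
   T (rv a) (rv b) =
   2^-1 * ((rv l)%:R * ((rv i)%:R + (rv b)%:R + (rv l)%:R - (rv a)%:R) * HH u N).
  move=> abi; have <- : (rv i + rv a + rv b - (rv l).+2 = N)%N by rewrite abi.
  by rewrite -chr_product_sum ?rv_lt // mulrA mulVf ?mul1r // pnatr_eq0.
have quad : \sum_(m < n) (Chr eta l j m u * Chr eta m k i u - Chr eta l k m u * Chr eta m j i u) =
    T (rv j) (rv k) - T (rv k) (rv j).
  rewrite /T -sumrB -(sum_rv (fun m => (rv l)%:R * hc u (rv j + m - (rv l).+1) *
     (m%:R * hc u (rv k + rv i - m.+1)) - (rv l)%:R * hc u (rv k + m - (rv l).+1) *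
     (m%:R * hc u (rv j + rv i - m.+1)))).
  apply: eq_bigr => m _; have C1 := ChrE l j m un0; have C2 := ChrE m k i un0.
  have C3 := ChrE l k m un0; have C4 := ChrE m j i un0.
  apply: (etrans (congr2 (fun a b => a - b) (congr2 *%R C1 C2) (congr2 *%R C3 C4))).
  by ring.
apply: (etrans (congr2 +%R (congr2 (fun a b => a - b) (pdC k j e1) (pdC j k e2)) quad)).
rewrite (TE j k); last by lia.
rewrite (TE k j); last by lia.
by field.
Qed.

(** The product z^(a-1) z^(b-1) is z^(a+b-2), the power reduced by [cs] at a + b. *)
Definition prodc (i j k : 'I_n) (u : pt) : C := cs u (rv i + rv j) (rv k).
Definition unite (i : 'I_n) (u : pt) : C := (rv i == 1%N)%:R.
Definition eulerE (i : 'I_n) (u : pt) : C := Efield u i.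

Lemma clE u i j k : uc u n != 0 -> cl eta prodc i j k u = n1 * mu u (rv i + rv j + rv k).
Proof.
move=> un0; rewrite /cl -(cs_hc hn _ un0 (rv_lt k)) mulr_sumr.
rewrite -(sum_rv (fun m => n1 * (cs u (rv i + rv j) m * hc u (m + rv k)))).
by apply: eq_bigr => m _; rewrite etalE // mulrCA.
Qed.

(* [dmu u l s] is the derivative of [mu u s] in the direction [rv i = l] *)
Definition dmu u (l s : nat) : C :=
  if s is t.+1 then (1 - l%:R) * HH u (t + l).-1 else - (uc u n) ^- 2 * (l == 0%N)%:R.

Lemma pd_cl u i j k l : uc u n != 0 ->
  pd (cl eta prodc i j k) l u = n1 * dmu u (rv l) (rv i + rv j + rv k).
Proof.
move=> un0.
rewrite (pd_local (U := U) (g := fun v => n1 * mu v (rv i + rv j + rv k))).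
- rewrite (derivationZ (pd_derivation l u)); last exact: differentiable_mu.
  congr (_ * _); case: (_ + _)%N => [|s].
    by rewrite pd_mu0 // -{1}(rvK l) pd_un // rv_lt.
  by rewrite /= -{1}(rvK l) pd_hc // rv_lt.
- exact: open_Udom.
- exact/UdomP.
- by move=> v /UdomP vn0; rewrite clE.
Qed.

Lemma Bsum_rv u x y :
  Bsum u x y = \sum_(m < n) (rv m)%:R * hc u (x - (rv m).+1) * mu u (rv m + y).
Proof. exact/esym/(sum_rv (fun m => m%:R * hc u (x - m.+1) * mu u (m + y))). Qed.

Lemma nabla_cE u l i j k : uc u n != 0 -> nabla_c eta prodc l i j k u =
  n1 * (dmu u (rv l) (rv i + rv j + rv k) + Bsum u (rv l + rv i) (rv j + rv k)
    + Bsum u (rv l + rv j) (rv i + rv k) + Bsum u (rv l + rv k) (rv i + rv j)).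
Proof.
move=> un0; rewrite /nabla_c pd_cl // !Bsum_rv !mulrDr -!addrA; congr (_ + _).
rewrite !mulr_sumr -!big_split -sumrN; apply: eq_bigr => m _ /=.
have X1 := congr2 *%R (ChrE m l i un0) (clE m j k un0).
have X2 := congr2 *%R (ChrE m l j un0) (clE i m k un0).
have X3 := congr2 *%R (ChrE m l k un0) (clE i j m un0).
apply: (etrans (congr1 -%R (congr2 +%R (congr2 +%R X1 X2) X3))).
rewrite (_ : rv i + rv j + rv m = rv m + (rv i + rv j))%N; last exact: addnC.
rewrite (_ : rv i + rv m + rv k = rv m + (rv i + rv k))%N; last by rewrite addnAC addnC.
by rewrite -(addnA (rv m)); ring.
Qed.

(** The exceptional value of [dmu] at index 0 carries a delta at direction 0, so it vanishes unless
    l = i, where the difference is trivially 0. *)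
Lemma dmu_sub u (l i s : nat) : (l < n)%N -> (i < n)%N ->
  dmu u l (i + s) - dmu u i (l + s) = (i%:R - l%:R) * HH u (l + i + s - 2).
Proof.
move=> ln iln.
have E a b : (0 < b)%N -> dmu u a b = (1 - a%:R) * HH u (a + b - 2).
  by case: b => // b _ /=; congr (_ * HH u _); lia.
have [->|li] := eqVneq l i; first by rewrite !subrr mul0r.
have small N : (N < n)%N -> HH u N = 0 by move=> Nn; rewrite HH_small //; lia.
have [is0|is0] := posnP (i + s).
  have [i0 s0] : i = 0%N /\ s = 0%N by lia.
  subst i s; rewrite (E 0%N (l + 0)%N) ?small ?mulr0 ?subr0 /=; [|lia..].
  by rewrite (negbTE li) mulr0.
have [ls0|ls0] := posnP (l + s).
  have [l0 s0] : l = 0%N /\ s = 0%N by lia.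
  subst l s; rewrite (E 0%N (i + 0)%N) ?small ?mulr0 ?sub0r /=; [|lia..].
  by rewrite eq_sym (negbTE li) mulr0 oppr0.
rewrite (E l _ is0) (E i _ ls0) (addnCA i) !addnA.
by ring.
Qed.

(** The term [Bsum] at (l+i, j+k) is symmetric. Twice the remaining difference is 2(i-l) + (l+j-i-k)
    + (l+k-i-j) = 0 times a common [HH]. *)
Lemma nabla_c_sym u l i j k : uc u n != 0 ->
  nabla_c eta prodc l i j k u = nabla_c eta prodc i l j k u.
Proof.
move=> un0; rewrite !nabla_cE //; congr (_ * _).
have := rv_lt l; have := rv_lt i; have := rv_lt j; have := rv_lt k.
move: (rv l) (rv i) (rv j) (rv k) => {l i j k} l i j k kn jn iln ln.
apply/eqP; rewrite -subr_eq0; apply/eqP.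
have D := dmu_sub u (j + k) ln iln.
have B1 := @Bsum_antisym _ _ hn u (l + j) (i + k).
have B2 := @Bsum_antisym _ _ hn u (l + k) (i + j).
rewrite (addnA i) (addnA l) in D.
have {}B1 := B1 ltac:(lia) ltac:(lia).
have {}B2 := B2 ltac:(lia) ltac:(lia).
rewrite (_ : l + j + (i + k) - 2 = l + i + (j + k) - 2)%N in B1; last by lia.
rewrite (_ : l + k + (i + j) - 2 = l + i + (j + k) - 2)%N in B2; last by lia.
rewrite (addnC i l).
apply: (mulfI (_ : 2 != 0 :> C)); first by rewrite pnatr_eq0.
rewrite mulr0 -(subrr (0 : C)).
transitivity (2 * (dmu u l (i + j + k) - dmu u i (l + j + k))
  + 2 * (Bsum u (l + j) (i + k) - Bsum u (i + k) (l + j))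
  + 2 * (Bsum u (l + k) (i + j) - Bsum u (i + j) (l + k))); first by ring.
by rewrite D B1 B2 !natrD; ring.
Qed.

Lemma pd_Efield u k l : pd (eulerE k) l u = k.+1%:R / n1 * (k == l)%:R.
Proof.
rewrite /eulerE /Efield; under eq_fun do rewrite -uc_ord.
rewrite (derivationZ (pd_derivation l u)); last exact: differentiable_uc.
by rewrite pd_uc // eqSS.
Qed.

Lemma sum_delta (I : finType) (F : I -> C) a : \sum_b F b * (a == b)%:R = F a.
Proof.
rewrite (bigD1 a) //= eqxx mulr1 big1 ?addr0 // => b /negbTE ba.
by rewrite eq_sym ba mulr0.
Qed.

Lemma ord_rv i : (i.+1%:R : C) = n%:R - (rv i)%:R.
Proof. by rewrite natrB ?subKr. Qed.

Lemma LE_cE u i j k : uc u n != 0 -> LE_c prodc eulerE i j k u = prodc i j k u.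
Proof.
move=> un0; rewrite /LE_c.
transitivity (Euler u (prodc i j k) - k.+1%:R / n1 * prodc i j k u
   + i.+1%:R / n1 * prodc i j k u + j.+1%:R / n1 * prodc i j k u).
  rewrite !big_split /= sumrN; congr (_ - _ + _ + _).
  - under eq_bigr => l _ do rewrite pd_Efield mulrA.
    by rewrite sum_delta mulrC.
  - under eq_bigr => l _ do rewrite pd_Efield eq_sym mulrA.
    by rewrite sum_delta mulrC.
  - under eq_bigr => l _ do rewrite pd_Efield eq_sym mulrA.
    by rewrite sum_delta mulrC.
rewrite /prodc Euler_cs ?rv_lt // !ord_rv natrD.
have := n1C; have -> : n%:R = n1 + 1 by rewrite natr1 prednK //; lia.
by move: (cs _ _ _) n1 => z m m0; field.
Qed.

(** Weights in units of 1/(n-1): h_(a+b) has a+b+1-n, and the two differentials add n-a and n-b. The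
    total n+1 is 2(n-1) - (n-3), whence d. *)
Lemma LE_etaE u i j : uc u n != 0 ->
  LE_eta eta eulerE i j u = (2 - (n%:R - 3) / n1) * etal eta u i j.
Proof.
move=> un0; rewrite /LE_eta !big_split /=.
have A1 : \sum_(l < n) eulerE l u * pd (fun v => etal eta v i j) l u =
    (rv i + rv j).+1%:R / n1 * etal eta u i j - n%:R / n1 * etal eta u i j.
  transitivity (Euler u (fun v => n1 * hc v (rv i + rv j))).
    apply: eq_bigr => l _; apply: (congr1 ( *%R (Efield u l))).
    apply: (pd_local l open_Udom (proj2 (UdomP u) un0)) => v /UdomP vn0.
    by rewrite etalE.
  rewrite (derivationZ (Euler_derivation u)); last exact: differentiable_hc.
  by rewrite Euler_hc // etalE //; ring.
have A2 : \sum_(l < n) etal eta u l j * pd (eulerE l) i u = i.+1%:R / n1 * etal eta u i j.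
  under eq_bigr => l _ do rewrite pd_Efield eq_sym mulrA.
  by rewrite sum_delta mulrC.
have A3 : \sum_(l < n) etal eta u i l * pd (eulerE l) j u = j.+1%:R / n1 * etal eta u i j.
  under eq_bigr => l _ do rewrite pd_Efield eq_sym mulrA.
  by rewrite sum_delta mulrC.
apply: (etrans (congr2 +%R (congr2 +%R A1 A2) A3)).
rewrite !ord_rv -natr1 natrD.
have := n1C; have -> : n%:R = n1 + 1 by rewrite natr1 prednK //; lia.
by move: (etal _ _ _ _) n1 => z m m0; field.
Qed.

Lemma intersection_formE u : uc u n != 0 -> intersection_form eta prodc eulerE u = g u.
Proof.
move=> un0; apply/matrixP => m j; rewrite mxE gE // -intersection_sum ?rv_lt //.
rewrite mulr_sumr -(sum_rv (fun k : nat => n1^-1 * \sum_(l < n) Ecoef u k * cs u (k + l) (rv m) *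
  qz u (l + rv j).+1)).
apply: eq_bigr => k _; rewrite mulr_sumr.
rewrite -(sum_rv (fun l : nat => n1^-1 * (Ecoef u (rv k) * cs u (rv k + l) (rv m) *
  qz u (l + rv j).+1))).
apply: eq_bigr => l _; rewrite etaE // /eulerE /Efield /Ecoef /prodc.
rewrite (_ : n - rv k = k.+1)%N; last by have := ltn_ord k; lia.
by rewrite uc_ord; ring.
Qed.

Lemma DubrovinFrobenius_superpotential :
  DubrovinFrobenius eta prodc unite eulerE ((n%:R - 3) / n1) U.
Proof.
have at_U (P : pt -> Prop) : (forall u, uc u n != 0 -> P u) -> forall u, U u -> P u.
  by move=> H u /UdomP; exact: H.
split; first exact: open_Udom.
split; first apply: at_U => u un0.
  split.
  - by apply/matrixP => i j; rewrite mxE !etaE // (addnC (rv i)).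
  - by have := eta_unit un0; rewrite unitmxE unitfE.
  - by move=> l i j k; exact: RiemE.
split.
  move=> i j; apply: at_U => u un0.
  apply: (differentiable_local open_Udom (proj2 (UdomP u) un0)
    (g := fun v => n1^-1 * qz v (rv i + rv j).+1)).
    by move=> v /UdomP vn0; rewrite etaE.
  apply: (differentiable_mul (f := fun=> _)); first exact: differentiable_cst.
  exact: differentiable_qz.
split.
  by move=> i j k; apply: at_U => u un0; exact: differentiable_cs.
split; first by move=> i u _; exact: differentiable_cst.
split.
  move=> i u _; apply: (differentiable_mul (f := fun=> _)); first exact: differentiable_cst.
  exact: differentiable_coord.
apply: at_U => u un0; do !split.
- by move=> i j k; rewrite /prodc addnC.
- move=> i j k l; rewrite /prodc.
  rewrite (sum_rv (fun m => cs u (rv i + rv j) m * cs u (m + rv k) (rv l))).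
  transitivity (\sum_(m < n) cs u (rv j + rv k) m * cs u (m + rv i) (rv l)).
    by rewrite !cs_assoc // (addnC (rv j + rv k)) addnA.
  rewrite -(sum_rv (fun m => cs u (rv j + rv k) m * cs u (m + rv i) (rv l))).
  by apply: eq_bigr => m _; rewrite (addnC (rv m)).
- move=> i j k; transitivity (cl eta prodc i j k u); first by [].
  transitivity (cl eta prodc j k i u).
    by rewrite !clE // -addnA addnC.
  by apply: eq_bigr => l _; rewrite !etalE // (addnC (rv l)).
- move=> j k; have n2 : (n.-2 < n)%N by lia.
  have e1 (i : 'I_n) : (rv i == 1)%N = (Ordinal n2 == i).
    by rewrite -val_eqE /=; have := ltn_ord i; lia.
  rewrite /unite; under eq_bigr => i _ do rewrite mulrC e1.
  rewrite sum_delta /prodc (_ : rv (Ordinal n2) = 1%N) /=; last by lia.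
  by rewrite add1n cs_unit ?rv_lt // rv_eq eq_sym.
- move=> i k; have [_ _ ->] := pd_derivation i u.
  have n2 : (n.-2 < n)%N by lia.
  have e1 (j : 'I_n) : (rv j == 1)%N = (Ordinal n2 == j).
    by rewrite -val_eqE /=; have := ltn_ord j; lia.
  rewrite add0r /unite; under eq_bigr => j _ do rewrite e1.
  rewrite sum_delta ChrE // (_ : rv (Ordinal n2) = 1%N) /=; last by lia.
  (* Flatness of the unit: the factor [rv k] kills the case 0, and otherwise h has index at most
     n-2. *)
  have [k0|k0] := posnP (rv k); first by rewrite k0 oppr0 mul0r.
  by rewrite hc_small ?mulr0 //; have := rv_lt i; lia.
- by move=> l i j k; exact: nabla_c_sym.
- move=> k; transitivity (\sum_(i < n) (unite i u * (k.+1%:R / n1)) * (k == i)%:R).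
    apply: eq_bigr => i _; have [_ _ ->] := pd_derivation i u.
    by rewrite mulr0 subr0 pd_Efield mulrA.
  rewrite sum_delta /unite; case: eqP => [k1|_]; last by rewrite mul0r.
  (* The unit direction is u_(n-1), whose Euler weight is 1. *)
  have -> : k.+1 = n.-1 by have := ltn_ord k; lia.
  by rewrite mul1r divff ?n1C.
- by move=> i j k; exact: LE_cE.
- by move=> i j; exact: LE_etaE.
Qed.

End OrbitSpace.

Theorem mainTheorem1 (R : realType) (n : nat) (hn : (2 <= n)%N)
    (g : 'rV[Cx R]_n -> 'M[Cx R]_n)
    (hg : forall p : 'rV[Cx R]_n, (forall k : 'I_n, p 0 k != 0) ->
            g (inv_u p) = ((4 * n.-1)%:R)^-1 *: \matrix_(i, j) g_pullback p i j) :
  exists (c : 'I_n -> 'I_n -> 'I_n -> 'rV[Cx R]_n -> Cx R)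
         (e E : 'I_n -> 'rV[Cx R]_n -> Cx R) (d : Cx R),
    DubrovinFrobenius (eta_of g) c e E d (@Udom R n) /\
    (forall u, (@Udom R n) u -> intersection_form (eta_of g) c E u = g u).
Proof.
exists (@prodc R n), (@unite R n), (@eulerE R n), ((n%:R - 3) / n.-1%:R).
split; first exact: DubrovinFrobenius_superpotential.
by move=> u /(UdomP hn); exact: intersection_formE.
Qed.
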